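(* Let $P\subseteq\mathbb{R}^d$ be a rational polytope. (1) If the weight $w$ is a homogeneous element of $R_P$, then all coefficients of $h^*_{P,w}(t)$ are nonnegative. (2) If the weight $w$ is a homogeneous element of $S_P$, then $h^*_{P,w}(t)\ge 0$ for all real $t\ge 0$.
   Context: For a rational polytope $P\subseteq\mathbb{R}^d$, its cone is $\mathrm{C}(P)=\{c(p,1)\mid c\ge 0,\ p\in P\}\subseteq\mathbb{R}^{d+1}$, and its denominator $\delta(P)$ is the smallest positive integer $q$ such that $qP$ has vertices in $\mathbb{Z}^d$ (the empty polytope has denominator $1$). For a polynomial $w$ on $\mathbb{R}^{d+1}$, $\mathrm{Ehr}(P,w;t)=\sum_{x\in\mathrm{C}(P)\cap\mathbb{Z}^{d+1}}w(x)t^{x_{d+1}}$. If $\dim P=r$ and $w$ is homogeneous of degree $m$, the weighted $h^*$-polynomial $h^*_{P,w}(t)$ is the polynomial with $\mathrm{Ehr}(P,w;t)=h^*_{P,w}(t)/(1-t^{\delta(P)})^{r+m+1}$. $R_P$ is the semiring of polynomials on $\mathbb{R}^{d+1}$ of the form $c_1p_1+\cdots+c_kp_k$ with $c_i>0$ real and each $p_i$ a product of linear forms on $\mathbb{R}^{d+1}$ each of which is nonnegative on $\mathrm{C}(P)$. $S_P$ is the semiring of sums of products of linear forms on $\mathbb{R}^{d+1}$ where each such product is nonnegative on $\mathrm{C}(P)$ (equivalently, sums of terms $s\cdot p$ with $s$ the square of a product of arbitrary linear forms and $p$ a product of linear forms nonnegative on $\mathrm{C}(P)$). *)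

(* Defs.v *)
From HB Require Import structures.
From mathcomp Require Import all_boot all_order all_algebra.
From mathcomp Require Import boolp classical_sets functions cardinality fsbigop.
From mathcomp Require Import reals.
From mathcomp Require Import mpoly.

Set Implicit Arguments.
Unset Strict Implicit.
Unset Printing Implicit Defensive.

Import Order.TTheory GRing.Theory Num.Theory.
Local Open Scope ring_scope.
Local Open Scope classical_set_scope.

Definition convex_hull (R : realType) (d : nat) (s : seq 'rV[R]_d) :
    set 'rV[R]_d :=
  [set x | exists c : 'I_(size s) -> R,
    [/\ forall i, 0 <= c i, \sum_i c i = 1 & x = \sum_i c i *: s`_i]].

(* [s] may be empty, so the empty polytope is included. *)
Definition rational_polytope (R : realType) (d : nat) (P : set 'rV[R]_d) : Prop :=
  exists s : seq 'rV[rat]_d, P = convex_hull [seq map_mx (@ratr R) v | v <- s].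

(* {v} is a face: some linear functional attains its maximum over P at v only. *)
Definition is_vertex (R : realType) (d : nat) (P : set 'rV[R]_d)
    (v : 'rV[R]_d) : Prop :=
  P v /\ exists c : 'cV[R]_d,
    forall x, P x -> x <> v -> (x *m c) 0 0 < (v *m c) 0 0.

Definition dilate (R : realType) (d : nat) (q : nat) (P : set 'rV[R]_d) :
    set 'rV[R]_d :=
  [set q%:R *: x | x in P].

Definition integral_point (R : realType) (d : nat) (v : 'rV[R]_d) : Prop :=
  exists z : 'rV[int]_d, v = map_mx intr z.

Definition is_denominator (R : realType) (d : nat) (P : set 'rV[R]_d)
    (q : nat) : Prop :=
  let clears k :=
    (0 < k)%N /\ forall v, is_vertex (dilate k P) v -> integral_point v in
  clears q /\ forall k, clears k -> (q <= k)%N.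

(* The default value 1 is irrelevant for rational polytopes, by
   [denominatorP] below. *)
Definition denominator (R : realType) (d : nat) (P : set 'rV[R]_d) : nat :=
  xget 1%N [set q | is_denominator P q].

(* P contains k + 1 affinely independent points x, x + M_1, ..., x + M_k. *)
Definition has_affine_simplex (R : realType) (d : nat) (P : set 'rV[R]_d)
    (k : nat) : Prop :=
  exists (x : 'rV[R]_d) (M : 'M[R]_(k, d)),
    [/\ P x, forall i, P (x + row i M) & row_free M].

(* Dimension of the affine hull; the empty set has dimension -1. *)
Definition dimension (R : realType) (d : nat) (P : set 'rV[R]_d) : int :=
  if `[< P = set0 >] then -1
  else (\max_(k < d.+1 | `[< has_affine_simplex P k >]) (k : nat))%N%:Z.

Definition cone (R : realType) (d : nat) (P : set 'rV[R]_d) :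
    set 'rV[R]_(d + 1) :=
  [set x | exists c : R, exists2 p : 'rV[R]_d,
    0 <= c /\ P p & x = c *: row_mx p (const_mx 1)].

Definition evalmp (R : realType) (n : nat) (w : {mpoly R[n]}) (x : 'rV[R]_n) : R :=
  w.@[fun i => x 0 i].

Definition slice (R : realType) (d : nat) (P : set 'rV[R]_d) (n : nat) :
    set 'rV[int]_(d + 1) :=
  [set x | cone P (map_mx intr x) /\ x 0 (rshift d ord0) = n%:Z].

(* Coefficient of t^n in the formal power series Ehr(P, w; t).  The sum is
   finite for polytopes, by [finite_slice] below. *)
Definition ehr_coef (R : realType) (d : nat) (P : set 'rV[R]_d)
    (w : {mpoly R[d + 1]}) (n : nat) : R :=
  \sum_(x \in slice P n) evalmp w (map_mx intr x).

Definition hstar_denom (R : realType) (d : nat) (P : set 'rV[R]_d) (m : nat) :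
    {poly R} :=
  (1 - 'X^(denominator P)) ^+ absz (dimension P + m%:Z + 1).

(* h is the polynomial h^*_{P,w} for w homogeneous of degree m, i.e.
   h(t) = (1 - t^delta)^(r+m+1) Ehr(P, w; t) as formal power series. *)
Definition is_weighted_hstar (R : realType) (d : nat) (P : set 'rV[R]_d)
    (m : nat) (w : {mpoly R[d + 1]}) (h : {poly R}) : Prop :=
  forall n, h`_n = \sum_(i < n.+1) (hstar_denom P m)`_i * ehr_coef P w (n - i).

Definition linear_form (R : realType) (n : nat) (l : {mpoly R[n]}) : Prop :=
  l \is 1.-homog.

Definition nonneg_on (R : realType) (n : nat) (C : set 'rV[R]_n)
    (f : {mpoly R[n]}) : Prop :=
  forall x, C x -> 0 <= evalmp f x.

(* The semiring R_P; each entry (c, ls) of [s] encodes c * \prod ls. *)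
Definition semiring_R (R : realType) (d : nat) (P : set 'rV[R]_d) :
    set {mpoly R[d + 1]} :=
  [set w | exists s : seq (R * seq {mpoly R[d + 1]}),
    (forall t, t \in s -> 0 < t.1 /\
       forall l, l \in t.2 -> linear_form l /\ nonneg_on (cone P) l) /\
    w = \sum_(t <- s) t.1 *: \prod_(l <- t.2) l].

(* The semiring S_P; only the products, not their factors, are required to be
   nonnegative on the cone. *)
Definition semiring_S (R : realType) (d : nat) (P : set 'rV[R]_d) :
    set {mpoly R[d + 1]} :=
  [set w | exists s : seq (seq {mpoly R[d + 1]}),
    (forall t, t \in s ->
       (forall l, l \in t -> linear_form l) /\
       nonneg_on (cone P) (\prod_(l <- t) l)) /\
    w = \sum_(t <- s) \prod_(l <- t) l].

Lemma weighted_hstar_unique (R : realType) (d : nat) (P : set 'rV[R]_d)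
    (m : nat) (w : {mpoly R[d + 1]}) (h1 h2 : {poly R}) :
  is_weighted_hstar P m w h1 -> is_weighted_hstar P m w h2 -> h1 = h2.
Proof. by move=> e1 e2; apply/polyP => n; rewrite e1 e2. Qed.

Lemma vertex_dilate_hull (R : realType) (d : nat) (s : seq 'rV[R]_d) (k : nat)
    (v : 'rV[R]_d) :
  is_vertex (dilate k (convex_hull s)) v ->
  exists2 u, u \in s & v = k%:R *: u.
Proof.
move=> [[x [c [c0 c1 xE]] xv] [f fP]].
apply: contrapT => nex.
have lt_f (i : 'I_(size s)) : (k%:R *: s`_i *m f) 0 0 < (v *m f) 0 0.
  apply: fP.
    exists s`_i => //.
    exists (fun j => (j == i)%:R); split => //.
    - by rewrite (bigD1 i) //= eqxx big1 ?addr0 // => j /negPf ->.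
    - rewrite (bigD1 i) //= eqxx scale1r big1 ?addr0 // => j /negPf ->.
      by rewrite scale0r.
  by move=> e; apply: nex; exists s`_i => //; apply: mem_nth.
have fv : (v *m f) 0 0 = \sum_i c i * (k%:R *: s`_i *m f) 0 0.
  rewrite -xv xE scaler_sumr mulmx_suml summxE; apply: eq_bigr => i _.
  by rewrite scalerA mulrC -scalerA -scalemxAl mxE.
have fv1 : (v *m f) 0 0 = \sum_i c i * (v *m f) 0 0.
  by rewrite -mulr_suml c1 mul1r.
have [i ci] : exists i, c i != 0.
  apply: contrapT => nc.
  have : \sum_i c i = 0.
    by apply: big1 => i _; apply/eqP/negP => /negP ci; apply: nc; exists i.
  by rewrite c1 => /eqP; rewrite oner_eq0.
suff : (v *m f) 0 0 < (v *m f) 0 0 by rewrite ltxx.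
rewrite {1}fv fv1 [ltLHS](bigD1 i) //= [ltRHS](bigD1 i) //=.
apply: ltr_leD.
  by rewrite ltr_pM2l // lt_neqAle eq_sym ci c0.
by apply: ler_sum => j _; apply: ler_wpM2l => //; apply: ltW.
Qed.

Lemma denominatorP (R : realType) (d : nat) (P : set 'rV[R]_d) :
  rational_polytope P -> is_denominator P (denominator P).
Proof.
move=> [s PE]; rewrite /denominator.
pose clears k := `[< (0 < k)%N /\
  forall v, is_vertex (dilate k P) v -> integral_point v >].
have ex : exists k, clears k.
  pose D (u : 'rV[rat]_d) := (\prod_(j < d) absz (denq (u ord0 j)))%N.
  have D0 u : (0 < D u)%N by apply: prodn_gt0 => j; rewrite absz_gt0 denq_neq0.
  exists (\prod_(u <- s) D u)%N; apply/asboolP; split.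
    by elim: (s) => [|u t IH]; rewrite ?big_nil ?big_cons // muln_gt0 D0.
  move=> v; rewrite PE => /vertex_dilate_hull[_ /mapP[u us ->] ->].
  have int_entry j : exists z : int,
      (\prod_(u0 <- s) D u0)%N%:R * u 0 j = z%:~R :> rat.
    rewrite (big_rem u) //= /D (bigD1 j) //=.
    set a := (\prod_(_ | _) _)%N; set b := (\prod_(_ <- _) _)%N.
    exists ((a * b)%N%:Z * numq (u 0 j)).
    rewrite -mulnA natrM [in LHS]mulrC mulrA.
    have -> : (absz (denq (u ord0 j)))%:R = (denq (u 0 j))%:~R :> rat.
      by rewrite -[in RHS]absz_denq.
    by rewrite -numqE mulrC [RHS]rmorphM.
  have [z zE] := choice int_entry.
  exists (\row_j z j); apply/rowP => j; rewrite !mxE.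
  by rewrite -(ratr_nat R) -rmorphM /= zE ratr_int.
have [q qP qmin] := ex_minnP ex.
case: xgetP => [x _ // | none]; exfalso; apply: (none q); split.
  by move/asboolP: qP.
by move=> k kP; apply: qmin; apply/asboolP.
Qed.

Lemma finite_slice (R : realType) (d : nat) (P : set 'rV[R]_d) (n : nat) :
  rational_polytope P -> finite_set (slice P n).
Proof.
move=> [s PE].
pose s' := [seq map_mx (@ratr R) v | v <- s].
pose B : R := \sum_(i < size s') \sum_j `|s'`_i 0 j|.
have B0 : 0 <= B by apply: sumr_ge0 => i _; apply: sumr_ge0.
have PB p j : P p -> `|p 0 j| <= B.
  rewrite PE => -[c [c0 c1 ->]]; rewrite summxE.
  apply: le_trans (ler_norm_sum _ _ _) _; apply: ler_sum => i _.
  rewrite mxE normrM (ger0_norm (c0 i)).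
  apply: (@le_trans _ _ `|s'`_i 0 j|).
    apply: ler_piMl => //; rewrite -c1 (bigD1 i) //= lerDl.
    by apply: sumr_ge0.
  by rewrite (bigD1 j) //= lerDl sumr_ge0.
pose N := (Num.truncn (n%:R * B + n%:R)).+1.
have NB : n%:R * B + n%:R < N%:R by apply: truncnS_gt.
have box x j : slice P n x -> (absz (x ord0 j) <= N)%N.
  move=> [[c [p [c0 Pp] xE]] xn].
  have xj i : (x 0 i)%:~R = (c *: row_mx p (const_mx 1)) 0 i :> R.
    by rewrite -xE mxE.
  have cE : c = n%:R.
    by have := xj (rshift d ord0); rewrite xn mxE row_mxEr mxE mulr1 => <-.
  rewrite -(ler_nat R) natr_absz intr_norm xj mxE cE normrM normr_nat.
  apply/ltW/(le_lt_trans _ NB).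
  case: (split_ordP j) => k ->.
    rewrite row_mxEl; apply: (@le_trans _ _ (n%:R * B)); last by rewrite lerDl.
    by rewrite ler_wpM2l // PB.
  by rewrite row_mxEr mxE normr1 mulr1 lerDr mulr_ge0.
pose F (g : {ffun 'I_(d + 1) -> 'I_(N + N).+1}) : 'rV[int]_(d + 1) :=
  \row_j ((g j : nat)%:Z - N%:Z).
apply: (@sub_finite_set _ _ (F @` setT)); last first.
  exact/finite_image/finite_finset.
move=> x xs; exists [ffun j => inord (absz (x ord0 j + N%:Z))] => //.
apply/rowP => j; rewrite mxE ffunE.
have := box x j xs; set y := x 0 j => yN.
have y1 : (- N%:Z <= y <= N%:Z)%R by rewrite -ler_norml -abszE lez_nat.
have /andP[y2 y3] := y1.
have y4 : 0 <= y + N%:Z by rewrite -lerBlDr sub0r.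
rewrite inordK ?gez0_abs ?addrK //.
by rewrite ltnS -lez_nat gez0_abs // PoszD lerD2r.
Qed.

(* Main.v *)
(** Let [u_i = delta (v_i, 1)], for [v_i] the vertices of [P]; these integer
    vectors generate the cone of [P].  A generic linear program (minimise a
    generic positive cost over the nonnegative combinations of the [u_i] equal
    to [x], after moving [x] infinitesimally in a generic direction) selects
    for every [x] in the cone exactly one basis among the [u_i].  This
    partitions the cone into half-open simplicial cones, and a lattice point
    of one of them is uniquely [y + sum k_i u_i], with [y] in a half-open unit
    box and [k] a vector of naturals.  Writing [y = sum l_i u_i] with
    [0 <= l_i <= 1], the weight at such a point is a homogeneous polynomial [g]
    in the [l_i + k_i], and each monomial of [g] contributes a product of
    one-variable series [sum_n (l + n)^k s^n = A_{l,k}(s) / (1 - s)^(k+1)],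
    where [s = t^delta].

    For (1), both the coefficients of [g] and those of [A_{l,k}] are
    nonnegative.  For (2), the contribution of a box point at [s < 1] is a
    limit of sums of values of the weight on the cone, hence nonnegative; the
    case [s = 1] follows by continuity, and [s > 1] reduces to [s < 1] by the
    reciprocity [A_{l,k}(s) = s^k A_{1-l,k}(1/s)], which replaces [l] by
    [1 - l]. *)

Require Import Defs.
From HB Require Import structures.
From mathcomp Require Import all_boot all_order all_algebra.
From mathcomp Require Import boolp classical_sets reals.
From mathcomp Require Import mpoly.
From mathcomp Require Import ring lra zify.
From mathcomp Require Import cardinality fsbigop.

Set Implicit Arguments.
Unset Strict Implicit.
Unset Printing Implicit Defensive.

Import Order.TTheory GRing.Theory Num.Theory.

Local Open Scope ring_scope.

(** * Shifted Eulerian polynomials *)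

Section Eulerian.
Variable R : realType.
Implicit Types (l s : R) (k n M : nat).

(* The numerator of [sum_n (l + n)^k X^n] over the denominator
   [(1 - X)^(k + 1)]. *)
Fixpoint eulerian l k : {poly R} :=
  if k is k'.+1 then
    l%:P * (1 - 'X) * eulerian l k' + 'X * (1 - 'X) * (eulerian l k')^`()
    + k'.+1%:R%:P * 'X * eulerian l k'
  else 1.

Lemma coef0_eulerianS l k : (eulerian l k.+1)`_0 = l * (eulerian l k)`_0.
Proof.
have -> : eulerian l k.+1 = l *: eulerian l k + 'X * ((k.+1%:R - l) *: eulerian l k
   + (1 - 'X) * (eulerian l k)^`()).
  by rewrite /= -!mul_polyC rmorphB /=; ring.
by rewrite coefD coefZ coefXM /= addr0.
Qed.

Lemma coefS_eulerianS l k n : (eulerian l k.+1)`_n.+1 =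
  (l + n.+1%:R) * (eulerian l k)`_n.+1 + (k.+1%:R - l - n%:R) * (eulerian l k)`_n.
Proof.
have -> : eulerian l k.+1 = l *: eulerian l k + 'X * ((k.+1%:R - l) *: eulerian l k
   + (eulerian l k)^`() - 'X * (eulerian l k)^`()).
  by rewrite /= -!mul_polyC rmorphB /=; ring.
rewrite coefD coefZ coefXM /= !coefD coefN coefZ coefXM coef_deriv.
case: n => [|n] /=; first by rewrite mulr1n subr0; ring.
by rewrite coef_deriv -[_ *+ n.+2]mulr_natr -[_ *+ n.+1]mulr_natr; ring.
Qed.

Lemma size_eulerian l k : (size (eulerian l k) <= k.+1)%N.
Proof.
elim: k => [|k IH]; first by rewrite size_poly1.
apply/leq_sizeP => -[//|n] kn; rewrite coefS_eulerianS.
rewrite [(eulerian l k)`_n.+1]nth_default ?(leq_trans IH) //; last by lia.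
rewrite [(eulerian l k)`_n]nth_default ?(leq_trans IH) //.
by rewrite !mulr0 addr0.
Qed.

(** In the coefficient recurrence both multipliers [l + n + 1] and [k + 1 - l - n] are nonnegative
    as long as [n <= k]; for larger [n] the second one meets a vanishing coefficient. *)
Lemma eulerian_coef_ge0 l k n : 0 <= l <= 1 -> 0 <= (eulerian l k)`_n.
Proof.
move=> /andP[l0 l1]; elim: k n => [|k IH] n.
  by rewrite coef1; case: (n == 0%N).
case: n => [|n]; first by rewrite coef0_eulerianS mulr_ge0.
rewrite coefS_eulerianS; apply: addr_ge0.
  by rewrite mulr_ge0 // addr_ge0.
have [kn|nk] := ltnP k n.
  by rewrite [X in _ * X]nth_default ?mulr0 // (leq_trans (size_eulerian l k)).
apply: mulr_ge0 => //; rewrite -(ler_nat R) in nk.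
by rewrite -natr1; lra.
Qed.

(** The recurrence is symmetric: replacing [l] by [1 - l] and reversing the coefficients exchanges
    its two multipliers. The extreme coefficients are treated apart, since one of the two terms
    vanishes there. *)
Lemma eulerian_coef_rev l k n : (n <= k)%N -> (eulerian l k)`_n = (eulerian (1 - l) k)`_(k - n).
Proof.
elim: k n => [|k IH] n nk; first by rewrite (_ : n = 0%N) //; lia.
have [->|n0] := eqVneq n 0%N.
  rewrite subn0 coef0_eulerianS coefS_eulerianS [X in _ * X + _]nth_default ?mulr0 ?add0r.
    by rewrite IH // subn0 -natr1; congr (_ * _); ring.
  exact: size_eulerian.
have [->|nk1] := eqVneq n k.+1.
  rewrite subnn coef0_eulerianS coefS_eulerianS [X in _ * X + _]nth_default ?size_eulerian //.
  by rewrite mulr0 add0r -natr1 IH // subnn; congr (_ * _); ring.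
case: n n0 nk nk1 => // n _ nk nk1; rewrite coefS_eulerianS.
have -> : (k.+1 - n.+1 = (k - n.+1).+1)%N by lia.
rewrite coefS_eulerianS !IH; try lia.
have -> : ((k - n.+1).+1 = k - n)%N by lia.
rewrite addrC; have -> : (k - n.+1)%:R = k%:R - n%:R - 1 :> R.
  by rewrite natrB; [rewrite -natr1; ring|lia].
have -> : (k - n)%:R = k%:R - n%:R :> R by rewrite natrB //; lia.
by rewrite -!natr1; congr (_ * _ + _ * _); ring.
Qed.

Lemma horner_eulerian_inv l k s : s != 0 ->
  (eulerian l k).[s] = s ^+ k * (eulerian (1 - l) k).[s^-1].
Proof.
move=> s0; rewrite !(horner_coef_wide _ (size_eulerian _ _)).
rewrite (reindex_inj rev_ord_inj) /= mulr_sumr; apply: eq_bigr => i _.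
rewrite subSS eulerian_coef_rev ?leq_subr // subKn; last by rewrite -ltnS.
rewrite mulrCA; congr (_ * _); rewrite exprVn.
have ik : (i <= k)%N by rewrite -ltnS.
by rewrite -[in s ^+ k](subnK ik) exprD -mulrA divff ?mulr1 // expf_neq0.
Qed.

Definition powsum l k M : {poly R} := \sum_(n < M) (l + n%:R) ^+ k *: 'X^n.

(** The operator [l + X d/dX] multiplies the coefficient of [X^n] by [l + n]. *)
Lemma powsumS l k M :
  powsum l k.+1 M = l%:P * powsum l k M + 'X * (powsum l k M)^`().
Proof.
rewrite /powsum raddf_sum !mulr_sumr -big_split; apply: eq_bigr => -[n _] _ /=.
rewrite derivZ derivXn -!mul_polyC exprSr mulrDr polyCD !polyCM.
case: n => [|n]; first by rewrite mulr0n polyC0; ring.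
by rewrite -[_ ^+ n *+ n.+1]mulr_natr exprS polyC_natr /=; ring.
Qed.

(** Finite form of the series identity, which avoids formal power series: the tail from index [M] on
    is [X^M] times the series for [l + M]. The induction step applies [l + X d/dX] to the identity
    for [k], hence the differentiated hypothesis [IH']. *)
Lemma eulerian_powsum l k M : (1 - 'X) ^+ k.+1 * powsum l k M
  = eulerian l k - 'X^M * eulerian (l + M%:R) k.
Proof.
elim: k => [|k IH].
  rewrite /powsum expr1 /= mulr1.
  rewrite -[in RHS](expr1n _ M) subrXX; congr (_ * _).
  apply: eq_bigr => i _.
  by rewrite expr0 scale1r expr1n mul1r.
have IH' := congr1 (fun p => p^`()) IH.
move: IH'; rewrite derivM derivB derivM derivXn -[_ *+ M]mulr_natr.
rewrite deriv_exp derivB derivX -polyC1 derivC polyC1 -pred_Sn -[_ *+ k.+1]mulr_natr.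
set F := powsum l k M in IH *; set a := eulerian l k in IH *.
set b := eulerian (l + M%:R) k in IH *.
rewrite powsumS -/F /= -/a -/b.
set F' := F^`(); set a' := a^`(); set b' := b^`() => IH'.
have -> : (1 - 'X) ^+ k.+2 * (l%:P * F + 'X * F') =
  (1 - 'X) * l%:P * ((1 - 'X) ^+ k.+1 * F)
  + 'X * (1 - 'X) * ((0 - 1) * (1 - 'X) ^+ k * k.+1%:R * F + (1 - 'X) ^+ k.+1 * F')
  + 'X * k.+1%:R * ((1 - 'X) ^+ k.+1 * F).
  by rewrite !exprS; ring.
rewrite IH' IH polyCD !polyC_natr.
case: M @F @b @F' @b' {IH IH'} => [|M] F b F' b'; first by rewrite /=; ring.
by rewrite /= exprS; ring.
Qed.

End Eulerian.

(** * Limits along the naturals *)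

Section Tends.
Variable R : realType.
Implicit Types (a b : nat -> R).

Definition tends a (L : R) := forall e : R, 0 < e ->
  exists M0, forall M, (M0 <= M)%N -> `|a M - L| <= e.

Lemma tends_ge0 a L : (forall M, 0 <= a M) -> tends a L -> 0 <= L.
Proof.
move=> a0 aL; rewrite leNgt; apply/negP => L0.
have [|M0 /(_ M0 (leqnn _))] := aL (- L / 2); first by lra.
by rewrite ler_norml; have := a0 M0; lra.
Qed.

Lemma tends_cst L : tends (fun=> L) L.
Proof. by move=> e e0; exists 0%N => M _; rewrite subrr normr0 ltW. Qed.

Lemma tendsD a b L K : tends a L -> tends b K -> tends (fun M => a M + b M) (L + K).
Proof.
move=> aL bK e e0; have e2 : 0 < e / 2 by rewrite divr_gt0.
have [M1 h1] := aL _ e2; have [M2 h2] := bK _ e2.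
exists (maxn M1 M2) => M; rewrite geq_max => /andP[/h1 {}h1 /h2 {}h2].
have -> : a M + b M - (L + K) = (a M - L) + (b M - K) by ring.
by apply: le_trans (ler_normD _ _) _; lra.
Qed.

Lemma tendsM a b L K : tends a L -> tends b K -> tends (fun M => a M * b M) (L * K).
Proof.
move=> aL bK e e0.
have K1 : 0 < `|K| + 1 by rewrite ltr_wpDl.
have L1 : 0 < `|L| + 1 by rewrite ltr_wpDl.
have [|M1 h1] := aL (e / 2 / (`|K| + 1)); first by rewrite !divr_gt0.
have [|M2 h2] := bK (Num.min 1 (e / 2 / (`|L| + 1))).
  by rewrite lt_min ltr01 !divr_gt0.
exists (maxn M1 M2) => M; rewrite geq_max => /andP[/h1 {}h1 /h2].
rewrite le_min => /andP[h21 h22].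
have -> : a M * b M - L * K = (a M - L) * b M + L * (b M - K) by ring.
apply: le_trans (ler_normD _ _) _; rewrite !normrM.
have bK1 : `|b M| <= `|K| + 1.
  rewrite -[b M](subrK K); apply: le_trans (ler_normD _ _) _; lra.
have := ler_pM (normr_ge0 _) (normr_ge0 _) h1 bK1.
have L2 : `|L| <= `|L| + 1 by rewrite lerDl.
have := ler_pM (normr_ge0 _) (normr_ge0 _) L2 h22.
rewrite [X in _ <= X]mulrC !divfK ?gt_eqF //; lra.
Qed.

Lemma tends_sum (I : Type) (r : seq I) (f : I -> nat -> R) (L : I -> R) :
  (forall i, tends (f i) (L i)) ->
  tends (fun M => \sum_(i <- r) f i M) (\sum_(i <- r) L i).
Proof.
move=> fL; elim: r => [|i r IH].
  by rewrite big_nil; under eq_fun do rewrite big_nil; exact: tends_cst.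
by rewrite big_cons; under eq_fun do rewrite big_cons; exact: tendsD.
Qed.

Lemma tends_prod (I : Type) (r : seq I) (f : I -> nat -> R) (L : I -> R) :
  (forall i, tends (f i) (L i)) ->
  tends (fun M => \prod_(i <- r) f i M) (\prod_(i <- r) L i).
Proof.
move=> fL; elim: r => [|i r IH].
  by rewrite big_nil; under eq_fun do rewrite big_nil; exact: tends_cst.
by rewrite big_cons; under eq_fun do rewrite big_cons; exact: tendsM.
Qed.

Lemma tends0_le a b : (forall M, `|a M| <= b M) -> tends b 0 -> tends a 0.
Proof.
move=> ab b0 e /b0[M0 h]; exists M0 => M /h; rewrite !subr0.
by move: (ab M); have := ler_norm (b M); lra.
Qed.

Lemma tends0_geometric_poly (s C : R) k : 0 <= s < 1 -> 0 <= C ->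
  tends (fun M => s ^+ M * (M%:R + C) ^+ k) 0.
Proof.
(* By Bernoulli [s <= r^(k+1)] for [r = 1 - h], so [s^M] provides [k + 1] factors [r^M]. Of these,
   [k] absorb the factors [M + C], each product being at most [K], and the last one decays like
   [1 / (h M)]. *)
move=> /andP[s0 s1] C0; set h := (1 - s) / k.+1%:R.
have h0 : 0 < h by rewrite divr_gt0 ?subr_gt0.
have h1 : h <= 1.
  have k1 : 1 <= k.+1%:R :> R by rewrite ler1n.
  by rewrite ler_pdivrMr ?ltr0Sn // mul1r; lra.
pose r := 1 - h.
have r0 : 0 <= r by rewrite /r; lra.
have rM M : r ^+ M * (1 + M%:R * h) <= 1.
  elim: M => [|M IH]; first by rewrite expr0; lra.
  apply: le_trans IH; rewrite exprSr -mulrA ler_wpM2l ?exprn_ge0 //.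
  have M0 : 0 <= M.+1%:R * (h * h) by apply: mulr_ge0 => //; apply: mulr_ge0;
    exact: ltW.
  by move: M0; rewrite /r -natr1; lra.
have bern j : 1 - j%:R * h <= r ^+ j.
  elim: j => [|j IH]; first by rewrite expr0; lra.
  rewrite exprSr; apply: le_trans (ler_wpM2r r0 IH).
  have j0 : 0 <= j%:R * (h * h) by apply: mulr_ge0 => //; apply: mulr_ge0;
    exact: ltW.
  by move: j0; rewrite /r -natr1; lra.
have sr : s <= r ^+ k.+1.
  by apply: le_trans (bern _); rewrite /h mulrCA divff ?pnatr_eq0 // mulr1; lra.
set K := h^-1 + C.
have K0 : 0 <= K by rewrite addr_ge0 // invr_ge0 ltW.
have rMh M : r ^+ M * M%:R <= h^-1.
  rewrite -(ler_pM2r h0) mulVf ?gt_eqF //.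
  by have := rM M; have := exprn_ge0 M r0; lra.
have rK M : r ^+ M * (M%:R + C) <= K.
  rewrite mulrDr lerD //; apply: ler_piMl => //.
  by apply: exprn_ile1; rewrite /r; lra.
move=> e e0; pose x := K ^+ k / h / e.
have x0 : 0 <= x.
  by apply: divr_ge0; [apply: divr_ge0;
    [exact: exprn_ge0|exact: ltW]|exact: ltW].
exists (Num.truncn x).+1 => M xM; rewrite subr0 ger0_norm; last first.
  by rewrite mulr_ge0 ?exprn_ge0 // addr_ge0.
apply: (@le_trans _ _ (r ^+ M * K ^+ k)).
  apply: (@le_trans _ _ ((r ^+ M) ^+ k.+1 * (M%:R + C) ^+ k)).
    rewrite ler_wpM2r ?exprn_ge0 ?addr_ge0 //.
    rewrite -exprM mulnC exprM; apply: lerXn2r; rewrite ?nnegrE ?exprn_ge0 //.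
  rewrite exprS -mulrA -exprMn ler_wpM2l ?exprn_ge0 //.
  apply: lerXn2r; rewrite ?nnegrE //.
  by apply: mulr_ge0; [exact: exprn_ge0|exact: addr_ge0].
have xM' : x < M%:R.
  by apply: lt_le_trans (truncnS_gt x) _; rewrite ler_nat.
have M0 : 0 < M%:R :> R by apply: le_lt_trans xM'.
rewrite -(ler_pM2r M0) mulrAC.
apply: (@le_trans _ _ (h^-1 * K ^+ k)); first by rewrite ler_wpM2r ?exprn_ge0.
have -> : h^-1 * K ^+ k = e * x by rewrite /x; field; rewrite !gt_eqF.
by rewrite ler_pM2l // ltW.
Qed.

(** [K] stays fixed during the induction on [k], so the base of the power does not change; each of
    the two terms of the recurrence costs at most a factor [|l| + K + 1]. *)
Lemma eulerian_coef_bound l K k n : (k <= K)%N ->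
  `|(eulerian l k)`_n| <= (2 * (`|l| + K%:R + 1)) ^+ k :> R.
Proof.
have c0 : 0 <= 2 * (`|l| + K%:R + 1) :> R by rewrite mulr_ge0 // !addr_ge0.
elim: k n => [|k IH] n kK.
  by rewrite coef1 expr0; case: (n == 0%N); rewrite ?normr1 ?normr0.
have kK' : (k <= K)%N by lia.
have kR : k.+1%:R <= K%:R :> R by rewrite ler_nat.
have term (x : R) j : ((j <= k)%N -> `|x| <= `|l| + K%:R + 1) ->
   `|x * (eulerian l k)`_j| <= (`|l| + K%:R + 1) * (2 * (`|l| + K%:R + 1)) ^+ k.
  move=> hx; have [jk|kj] := leqP j k.
    by rewrite normrM ler_pM // ?hx // IH.
  rewrite [X in _ * X]nth_default ?(leq_trans (size_eulerian l k)) //.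
  by rewrite mulr0 normr0 mulr_ge0 ?exprn_ge0 // !addr_ge0.
rewrite exprS -mulrA mulr2n mulrDl mul1r.
case: n => [|n].
  rewrite coef0_eulerianS ler_wpDl ?mulr_ge0 ?exprn_ge0 ?addr_ge0 //.
  by apply: term => _; have : 0 <= K%:R :> R by []; lra.
rewrite coefS_eulerianS; apply: le_trans (ler_normD _ _) _; apply: lerD.
  apply: term => nk; apply: le_trans (ler_normD _ _) _.
  by rewrite normr_nat; rewrite -(ler_nat R) -natr1 in nk;
    rewrite -!natr1 in kR *; lra.
apply: term => nk; rewrite -(ler_nat R) in nk.
have n0 : 0 <= n%:R :> R by [].
rewrite ler_norml; have := ler_norm l; have := ler_norm (- l); rewrite normrN.
by move=> *; apply/andP; split; rewrite -!natr1 in kR *; lra.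
Qed.

(** The coefficients for the shift [l + M] grow at most like [M^k], which [s^M] kills. *)
Lemma tends0_eulerian_tail (s l : R) k : 0 <= s < 1 ->
  tends (fun M => s ^+ M * (eulerian (l + M%:R) k).[s]) 0.
Proof.
move=> s01; have /andP[s0 s1] := s01.
pose C := `|l| + k%:R + 1.
have C0 : 0 <= C by rewrite !addr_ge0.
apply: (@tends0_le _ (fun M => (k.+1%:R * 2 ^+ k) * (s ^+ M * (M%:R + C) ^+ k))).
  move=> M; rewrite normrM normrX (ger0_norm s0) [leRHS]mulrCA.
  rewrite ler_wpM2l ?exprn_ge0 // (horner_coef_wide _ (size_eulerian _ _)).
  apply: le_trans (ler_norm_sum _ _ _) _.
  apply: (@le_trans _ _ (\sum_(i < k.+1) (2 * (M%:R + C)) ^+ k)); last first.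
    by rewrite sumr_const card_ord exprMn -[leLHS]mulr_natl mulrA.
  apply: ler_sum => i _; rewrite normrM -[leRHS]mulr1 ler_pM //; last first.
    by rewrite normrX (ger0_norm s0) exprn_ile1 // ltW.
  apply: le_trans (eulerian_coef_bound _ _ (leqnn k)) _.
  apply: lerXn2r; rewrite ?nnegrE ?mulr_ge0 ?addr_ge0 //.
  by rewrite ler_pM2l //; have := ler_normD l M%:R; rewrite normr_nat /C; lra.
rewrite -(mulr0 (k.+1%:R * 2 ^+ k)); apply: tendsM; first exact: tends_cst.
exact: tends0_geometric_poly.
Qed.

Lemma poly_ge0_at1 (p : {poly R}) :
  (forall s, 0 <= s < 1 -> 0 <= p.[s]) -> 0 <= p.[1].
Proof.
move=> p0; rewrite leNgt; apply/negP => p1.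
have /factor_theorem[q pq] : root (p - p.[1]%:P) 1.
  by rewrite /root hornerD hornerN hornerC subrr.
pose K := \sum_(i < size q) `|q`_i|.
have K0 : 0 <= K by apply: sumr_ge0.
(* Here [K] bounds the quotient [q] on [[0, 1]], and [x] solves [p(1) + K x = x p(1)]; hence
   [p(1 - x) <= x p(1) < 0], a contradiction. *)
pose x := - p.[1] / (K - p.[1]).
have D0 : 0 < K - p.[1] by lra.
have x0 : 0 < x by rewrite divr_gt0 ?oppr_gt0.
have x1 : x <= 1 by rewrite ler_pdivrMr // mul1r; lra.
have xE : x * (K - p.[1]) = - p.[1] by rewrite divfK ?gt_eqF.
have s01 : 0 <= 1 - x < 1 by lra.
have := p0 _ s01; rewrite -[p](subrK p.[1]%:P) pq !hornerE.
have -> : 1 - x - 1 = - x by ring.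
have : `|q.[1 - x]| <= K.
  rewrite horner_coef; apply: le_trans (ler_norm_sum _ _ _) _.
  apply: ler_sum => i _; rewrite normrM ler_piMr // normrX ger0_norm; last lra.
  by apply: exprn_ile1; lra.
rewrite ler_norml => /andP[q1 q2].
have xq : - (q.[1 - x] * x) <= K * x by rewrite -mulNr ler_pM2r //; lra.
have xp : x * p.[1] < 0 by rewrite pmulr_rlt0.
lra.
Qed.

End Tends.

(** * Weighted sums over a translated orthant *)

Section Numerator.
Variables (R : realType) (N : nat) (g : {mpoly R[N]}) (B : {set 'I_N}).
Implicit Types (l : 'I_N -> R) (M : nat).

(** A coordinate outside [B] is meant to stay at 0, so its series reduces to the single value
    [0^e]. *)
Definition orthant_factor l (e : 'X_{1..N}) (i : 'I_N) : {poly R} :=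
  if i \in B then eulerian (l i) (e i) else (e i == 0%N)%:R.

(* The numerator, over the denominator [(1 - X)^(m + #|B|)] for [g] homogeneous
   of degree [m], of the series summing [g (l + k) X^|k|] over the natural
   vectors [k] supported in [B]. *)
Definition orthant_num l : {poly R} :=
  \sum_(e <- msupp g) g@_e *: \prod_i orthant_factor l e i.

(** Phrased with [family], so that expanding a product over the coordinates of sums yields exactly
    this index set. *)
Definition supported_in M (k : {ffun 'I_N -> 'I_M.+1}) : bool :=
  k \in family (fun i => [pred j : 'I_M.+1 | (i \in B) || (j == ord0)]).

Definition orthant_sum l M : {poly R} :=
  \sum_(k : {ffun 'I_N -> 'I_M.+1} | supported_in k)
     g.@[fun i => l i + (k i)%:R] *: 'X^(\sum_i k i).

Lemma orthant_sumE l M m : g \is m.-homog -> (forall i, i \notin B -> l i = 0) ->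
  (1 - 'X) ^+ (m + #|B|) * orthant_sum l M =
  \sum_(e <- msupp g) g@_e *: \prod_i (orthant_factor l e i
     - 'X^(M.+1) * if i \in B then eulerian (l i + M.+1%:R) (e i) else 0).
Proof.
move=> gm l0.
have -> : orthant_sum l M = \sum_(e <- msupp g) g@_e *:
   \prod_i \sum_(j < M.+1 | (i \in B) || (j == ord0))
      ((l i + j%:R) ^+ e i *: 'X^j).
  under eq_bigr => e _ do rewrite bigA_distr_big_dep scaler_sumr.
  rewrite exchange_big /=; apply: eq_big => k //= _.
  rewrite mevalE scaler_suml; apply: eq_bigr => e _.
  by rewrite scaler_prod -scalerA expr_sum.
rewrite mulr_sumr; apply: eq_big_seq => e eg.
rewrite -scalerAr; congr (_ *: _).
(* Homogeneity lets the denominator be distributed over the coordinates: coordinate [i] receives the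
   exponent [e i + 1] if it lies in [B], and [e i] otherwise. *)
have -> : (m + #|B| = \sum_i (e i + (i \in B)))%N.
  rewrite big_split /= -mdegE (dhomog_mf gm eg); congr addn.
  by rewrite -sum1_card big_mkcond.
rewrite expr_sum -big_split /=; apply: eq_bigr => i _.
rewrite /orthant_factor; case: ifPn => iB /=.
  by rewrite addn1 -eulerian_powsum.
rewrite addn0 mulr0 subr0 big_pred1_eq l0 // addr0 expr0n expr0 alg_polyC.
by case: (e i) => [|n]; rewrite /= ?mulr1 ?mulr0 ?polyC0 ?mulr0.
Qed.

(** A coefficient of the product with the series only involves a truncation, so it is enough to know
    the truncated product modulo a high power of [X]. *)
Lemma orthant_sum_mod l M m : g \is m.-homog ->
  (forall i, i \notin B -> l i = 0) ->
  exists E : {poly R}, (1 - 'X) ^+ (m + #|B|) * orthant_sum l M =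
    orthant_num l + 'X^(M.+1) * E.
Proof.
move=> gm l0; rewrite (orthant_sumE M gm l0) /orthant_num.
(* [K] is congruence modulo [X^(M+1)], which sums and products preserve. *)
pose K (p q : {poly R}) := exists E, p = q + 'X^(M.+1) * E.
rewrite -/(K _ _); apply: (big_ind2 K).
- by exists 0; rewrite mulr0 addr0.
- by move=> p p' q q' [E ->] [E' ->]; exists (E + E'); ring.
move=> e _.
have [E ->] : K (\prod_i (orthant_factor l e i
     - 'X^(M.+1) * if i \in B then eulerian (l i + M.+1%:R) (e i) else 0))
     (\prod_i orthant_factor l e i); last first.
  by exists (g@_e *: E); rewrite scalerDr -scalerAr.
apply: (big_ind2 K).
- by exists 0; rewrite mulr0 addr0.
- move=> p p' q q' [E ->] [E' ->].
  by exists (p' * E' + E * q' + E * 'X^(M.+1) * E'); ring.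
by move=> i _; eexists; rewrite -mulrN; reflexivity.
Qed.

Lemma orthant_num_coef_ge0 l n : (forall e, 0 <= g@_e) ->
  (forall i, 0 <= l i <= 1) -> 0 <= (orthant_num l)`_n.
Proof.
move=> g0 l01; rewrite coef_sum; apply: sumr_ge0 => e _.
rewrite coefZ mulr_ge0 //.
apply: (big_ind (fun p : {poly R} => forall n, 0 <= p`_n)) n => [n|p q p0 q0 n|i _ n].
- by rewrite coef1; case: (n == 0%N).
- by rewrite coefM; apply: sumr_ge0 => i _; rewrite mulr_ge0.
rewrite /orthant_factor; case: ifP => _; first exact: eulerian_coef_ge0.
by case: (e i == 0%N); rewrite ?coef1 ?coef0 //; case: (n == 0%N).
Qed.

Hypothesis g_ge0 : forall x : 'I_N -> R, (forall i, 0 <= x i) -> 0 <= g.@[x].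
Variable m : nat.
Hypothesis g_homog : g \is m.-homog.

Lemma orthant_num_ge0_lt1 l s : (forall i, 0 <= l i) ->
  (forall i, i \notin B -> l i = 0) -> 0 <= s < 1 -> 0 <= (orthant_num l).[s].
Proof.
move=> l0 lB s01; have /andP[s0 s1] := s01.
pose a M := ((1 - 'X) ^+ (m + #|B|) * orthant_sum l M).[s].
apply: (@tends_ge0 _ a).
  move=> M; rewrite /a hornerM horner_exp !hornerE mulr_ge0 //.
    by rewrite exprn_ge0 // subr_ge0 ltW.
  rewrite horner_sum sumr_ge0 // => k _; rewrite hornerZ hornerXn.
  by rewrite mulr_ge0 ?exprn_ge0 // g_ge0 // => i; rewrite addr_ge0.
(* Only the corrections carrying [X^(M+1)] depend on [M], and they tend to 0 at [s < 1]. *)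
rewrite /a; under eq_fun => M do rewrite (orthant_sumE M g_homog lB) horner_sum.
rewrite /orthant_num horner_sum; apply: tends_sum => e.
under eq_fun => M do rewrite hornerZ horner_prod.
rewrite hornerZ horner_prod; apply: tendsM; first exact: tends_cst.
apply: tends_prod => i.
set F := orthant_factor l e i.
set G := fun M => if i \in B then eulerian (l i + M.+1%:R) (e i) else 0.
have h : tends (fun M => F.[s] + -1 * (s ^+ M.+1 * (G M).[s])) (F.[s] + -1 * 0).
  apply: tendsD; first exact: tends_cst.
  apply: tendsM; first exact: tends_cst.
  rewrite /G; case: (i \in B) => eps eps0; last first.
    by exists 0%N => M _; rewrite horner0 mulr0 subr0 normr0 ltW.
  have [M0 h] := tends0_eulerian_tail (l i) (e i) s01 eps0.
  by exists M0 => M MM; apply: (h M.+1); lia.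
rewrite mulr0 addr0 in h => eps /h[M0 hM]; exists M0 => M /hM.
by rewrite hornerD hornerN hornerM hornerXn mulN1r.
Qed.

(* Reciprocity: [l] is replaced by the opposite corner of the unit box. *)
Lemma orthant_num_inv l s : s != 0 -> (orthant_num l).[s] =
  s ^+ m * (orthant_num (fun i => if i \in B then 1 - l i else 0)).[s^-1].
Proof.
move=> s0; rewrite /orthant_num !horner_sum mulr_sumr;
  apply: eq_big_seq => e eg.
rewrite !hornerZ mulrCA; congr (_ * _).
have -> : m = (\sum_i e i)%N by rewrite -mdegE (dhomog_mf g_homog eg).
rewrite expr_sum !horner_prod -big_split /=.
apply: eq_bigr => i _; rewrite /orthant_factor; case: ifP => iB.
  exact: horner_eulerian_inv.
by case: (e i) => [|n]; rewrite /= ?hornerC ?mulr1 ?mulr0.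
Qed.

Lemma orthant_num_ge0 l s : (forall i, 0 <= l i <= 1) ->
  (forall i, i \notin B -> l i = 0) -> 0 <= s -> 0 <= (orthant_num l).[s].
Proof.
move=> l01 lB s0.
have lt1 l' : (forall i, 0 <= l' i <= 1) -> (forall i, i \notin B -> l' i = 0) ->
    forall s, 0 <= s < 1 -> 0 <= (orthant_num l').[s].
  by move=> h1 h2 s' h3; apply: orthant_num_ge0_lt1 => // i;
    have /andP[] := h1 i.
case: (ltgtP s 1) => [s1|s1|->].
- by apply: lt1 => //; rewrite s0.
- rewrite orthant_num_inv ?gt_eqF ?(lt_trans ltr01) // mulr_ge0 ?exprn_ge0 //.
  apply: lt1.
  + by move=> i; case: ifP => _; have := l01 i; lra.
  + by move=> i /negPf ->.
  + by rewrite invr_ge0 s0 invf_lt1 // (lt_trans ltr01).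
- by apply: poly_ge0_at1; apply: lt1.
Qed.

End Numerator.

(** * Half-open decomposition of a cone by linear programming *)

Section FiniteChoices.
Variable R : realType.

Lemma small_multiplier (I : finType) (P : pred I) (f a : I -> R) :
  (forall i, P i -> 0 < f i) ->
  exists2 e, 0 < e & forall i, P i -> e * `|a i| < f i.
Proof.
move=> f0; pose s := 1 + \sum_(i | P i) `|a i| / f i.
have t0 i : P i -> 0 <= `|a i| / f i by move=> Pi; rewrite divr_ge0 // ltW ?f0.
have s0 : 0 < s by rewrite ltr_pwDl ?ltr01 // sumr_ge0.
exists s^-1; first by rewrite invr_gt0.
move=> i Pi; rewrite mulrC ltr_pdivrMr // -ltr_pdivrMl ?f0 // mulrC.
rewrite /s (bigD1 i) //= addrCA ltrDl ltr_pwDl ?ltr01 // sumr_ge0 //.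
by move=> j /andP[/t0].
Qed.

(** The product of the polynomials has fewer roots than its size, so one of the positive integers up
    to that size is a root of none of them. This meets finitely many genericity conditions with a
    single parameter. *)
Lemma common_nonroot (I : finType) (p : I -> {poly R}) :
  (forall i, p i != 0) -> exists2 T, 0 < T & forall i, (p i).[T] != 0.
Proof.
move=> p0; pose q := \prod_i p i.
have q0 : q != 0 by apply/prodf_neq0 => i _.
pose r := [seq n.+1%:R : R | n <- iota 0 (size q)].
have ur : uniq r.
  rewrite map_inj_uniq ?iota_uniq // => m n /eqP.
  by rewrite eqr_nat => /eqP[].
have /allPn[T /mapP[n _ TE] qT] : ~~ all (root q) r.
  apply/negP => rq; have := max_poly_roots q0 rq ur.
  by rewrite size_map size_iota ltnn.
exists T => [|i]; first by rewrite TE.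
apply: contra qT => /eqP pT; rewrite rootE /q horner_prod.
by rewrite (bigD1 i) //= pT mul0r.
Qed.

End FiniteChoices.

Section LinearProgram.
Variables (R : realType) (N D : nat) (U : 'M[R]_(N, D)).
Implicit Types (B : {set 'I_N}) (mu nu : 'rV[R]_N) (x z : 'rV[R]_D).

(** Zeroing the rows outside [B], rather than extracting a submatrix, keeps all coordinate vectors
    indexed by ['I_N] for every [B]. *)
Definition mask B : 'M[R]_N := diag_mx (\row_i (i \in B)%:R).

Definition supported mu B := forall i, i \notin B -> mu 0 i = 0.

Definition row_indep B := forall mu, supported mu B -> mu *m U = 0 -> mu = 0.

Definition is_basis B := row_indep B /\ (U <= mask B *m U)%MS.

(* Meaningful only for a basis [B]: the pseudo-inverse alone may have nonzero
   coordinates outside [B]. *)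
Definition coords B : 'M[R]_(D, N) := pinvmx (mask B *m U) *m mask B.

Definition in_cone x := exists2 mu : 'rV[R]_N, (forall i, 0 <= mu 0 i) & x = mu *m U.

Lemma mul_maskE mu B i : (mu *m mask B) 0 i = mu 0 i * (i \in B)%:R.
Proof. by rewrite mul_mx_diag !mxE. Qed.

Lemma supported_mask mu B : supported mu B -> mu *m mask B = mu.
Proof.
move=> h; apply/rowP => i; rewrite mul_maskE.
by case: (boolP (i \in B)) => [|/h ->]; rewrite ?mulr1 ?mulr0.
Qed.

Lemma supported_coords x B : supported (x *m coords B) B.
Proof.
by move=> i /negPf iB; rewrite /coords mulmxA mul_maskE iB mulr0.
Qed.

Lemma coordsK x B : is_basis B -> (x <= U)%MS -> x *m coords B *m U = x.
Proof.
move=> [_ UB] xU; rewrite /coords mulmxA -[_ *m mask B *m U]mulmxA mulmxKpV //.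
exact: submx_trans xU UB.
Qed.

Lemma coords_unique mu B : is_basis B -> supported mu B -> mu *m U *m coords B = mu.
Proof.
move=> bB mB; apply/eqP; rewrite -subr_eq0; apply/eqP; apply: (proj1 bB).
  move=> i iB; have := supported_coords (mu *m U) iB.
  by rewrite !mxE => ->; rewrite mB // subr0.
by rewrite mulmxBl coordsK ?submxMl // subrr.
Qed.

Lemma supported_delta j B : j \in B -> supported (delta_mx 0 j) B.
Proof.
by move=> jB i iB; rewrite mxE eqxx /= (_ : i == j = false) //;
  apply: contraNF iB => /eqP ->.
Qed.

Lemma coords_row j B : is_basis B -> j \in B -> row j U *m coords B = delta_mx 0 j.
Proof.
by move=> bB jB; rewrite rowE coords_unique //; apply: supported_delta.
Qed.

Lemma basis_extension B : row_indep B -> exists2 B', is_basis B' & B \subset B'.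
Proof.
move=> iB.
have [B' /maxsetP[/asboolP iB' maxB'] BB'] :=
  @maxset_exists _ (fun A => `[< row_indep A >]) B (introT (asboolP _) iB).
exists B' => //; split=> //; apply/row_subP => i; apply/negPn/negP => iU.
have iB0 : i \notin B'.
  apply: contra iU => iB0; rewrite rowE -(supported_mask (supported_delta iB0)).
  by rewrite -mulmxA submxMl.
suff h : row_indep (i |: B').
  have := maxB' _ (introT (asboolP _) h) (finset.subsetUr _ _) => E.
  by rewrite -E finset.setU11 in iB0.
move=> mu mB muU; have [mi|mi] := eqVneq (mu 0 i) 0.
  apply: iB' => // j jB; have [->//|ji] := eqVneq j i.
  by apply: mB; rewrite !inE negb_or ji.
(* A dependence involving row [i] can be solved for that row, which would put it in the span of the
   rows in [B']. *)
case/negP: iU; pose nu := delta_mx 0 i - (mu 0 i)^-1 *: mu.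
have nB : supported nu B'.
  move=> j jB; rewrite !mxE /=; have [->|ji] := eqVneq j i.
    by rewrite mulVf // subrr.
  rewrite (_ : mu 0 j = 0) ?mulr0 ?subrr //.
  by apply: mB; rewrite !inE negb_or ji.
have -> : row i U = nu *m (mask B' *m U).
  by rewrite mulmxA supported_mask // mulmxBl -scalemxAl muU scaler0 subr0 rowE.
exact: submxMl.
Qed.

Section Cost.
Variable c : 'cV[R]_N.
Hypothesis c_gt0 : forall i, 0 < c i 0.

Definition cost mu : R := (mu *m c) 0 0.

Lemma costE mu : cost mu = \sum_i mu 0 i * c i 0.
Proof. by rewrite /cost mxE. Qed.

Lemma cost_lin t mu nu : cost (mu + t *: nu) = cost mu + t * cost nu.
Proof. by rewrite /cost mulmxDl -scalemxAl !mxE. Qed.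

Definition rsupp mu : {set 'I_N} := [set i | mu 0 i != 0].

(** Subtract multiples of a linear dependence [nu] among the rows in the support, oriented so that
    its cost is nonnegative, until a coordinate vanishes: the support shrinks and the cost does not
    grow. *)
Lemma caratheodory mu : (forall i, 0 <= mu 0 i) ->
  exists nu, [/\ forall i, 0 <= nu 0 i, nu *m U = mu *m U,
                 row_indep (rsupp nu) & cost nu <= cost mu].
Proof.
have [n] := ubnP #|rsupp mu|; elim: n mu => // n IH mu ltn mu0.
have [ind|] := pselect (row_indep (rsupp mu)); first by exists mu; split.
move=> /existsNP[nu] /not_implyP[nB /not_implyP[nU nn0]].
wlog cn : nu nB nU nn0 / 0 <= cost nu.
  move=> wl; have [cn|cn] := leP 0 (cost nu); first exact: (wl nu).
  apply: (wl (- nu)).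
  - by move=> i iB; rewrite mxE nB ?oppr0.
  - by rewrite mulNmx nU oppr0.
  - by move/eqP; rewrite oppr_eq0 => /eqP.
  - by rewrite /cost mulNmx mxE oppr_ge0 ltW.
(* Otherwise [nu <= 0]; all costs being positive, a nonnegative total cost would force [nu = 0]. *)
have [i0 ni0] : exists i, 0 < nu 0 i.
  apply: contrapT => /forallNP h; apply: nn0.
  have n0 i : nu 0 i <= 0 by rewrite leNgt; apply/negP/h.
  have t0 i : 0 <= - (nu 0 i * c i 0).
    by rewrite -mulNr mulr_ge0 ?oppr_ge0 // ltW.
  have /eqP : \sum_i - (nu 0 i * c i 0) = 0.
    apply/eqP; rewrite eq_le sumr_ge0 // andbT sumrN oppr_le0 -costE //.
  rewrite psumr_eq0 // => /allP h0; apply/rowP => i; rewrite [RHS]mxE.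
  have := h0 i (mem_index_enum i); rewrite oppr_eq0 mulf_eq0.
  by rewrite (gt_eqF (c_gt0 i)) orbF => /eqP.
(* Ratio test: the minimal ratio is the largest step that keeps all coordinates nonnegative, and it
   annihilates coordinate [i]. *)
have [i ni imin] := @Order.TotalTheory.arg_minP _ R _ i0
  (fun i => 0 < nu 0 i) (fun i => mu 0 i / nu 0 i) ni0.
set th := mu 0 i / nu 0 i in imin.
have th0 : 0 <= th by rewrite divr_ge0 // ltW.
pose mu' := mu - th *: nu.
have mu'i : mu' 0 i = 0 by rewrite !mxE /th divfK ?subrr // gt_eqF.
have mu'0 j : 0 <= mu' 0 j.
  rewrite !mxE subr_ge0; have [nj|nj] := ltP 0 (nu 0 j).
    by rewrite -ler_pdivlMr // imin.
  by apply: le_trans (mu0 j); rewrite mulr_ge0_le0.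
have mu'U : mu' *m U = mu *m U by rewrite mulmxBl -scalemxAl nU scaler0 subr0.
have c' : cost mu' <= cost mu.
  by rewrite /mu' -scaleNr cost_lin mulNr lerBlDr lerDl mulr_ge0.
have [||nu' [h1 h2 h3 h4]] := IH mu'; last 1 first.
- by exists nu'; split; rewrite ?h2 // (le_trans h4).
- apply: leq_trans (ltn : (#|_| <= n)%N); apply: proper_card.
  apply/fintype.properP; split.
    apply/fintype.subsetP => j; rewrite !inE; apply: contraNneq => mj.
    by rewrite !mxE mj sub0r nB ?mulr0 ?oppr0 // inE mj eqxx.
  exists i; rewrite inE ?mu'i ?eqxx //; apply: contraTneq ni => mi.
  by rewrite nB ?ltxx // inE mi eqxx.
- exact: mu'0.
Qed.

Lemma feasible_basis z mu : (forall i, 0 <= mu 0 i) -> z = mu *m U ->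
  exists B, [/\ is_basis B, forall i, 0 <= (z *m coords B) 0 i &
                cost (z *m coords B) <= cost mu].
Proof.
move=> mu0 ->; have [nu [n0 <- ni nc]] := caratheodory mu0.
have [B bB sB] := basis_extension ni; exists B.
have -> : nu *m U *m coords B = nu; last by split.
apply: coords_unique => // i iB; apply/eqP; apply: contraNT iB => ni0.
by apply: (fintype.subsetP sB); rewrite inE.
Qed.

(** Simplex optimality criterion. By nondegeneracy the coordinates of [z] in a cheapest feasible
    basis are positive on it, so a small amount of any generator [j] can be exchanged in. If that
    lowered the cost, [feasible_basis] would return a cheaper basis. *)
Lemma optimal_basis z : in_cone z ->
  (forall B i, is_basis B -> i \in B -> (z *m coords B) 0 i != 0) ->
  exists B, [/\ is_basis B, forall i, i \in B -> 0 < (z *m coords B) 0 i &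
     forall j, cost (row j U *m coords B) <= c j 0].
Proof.
move=> [mu mu0 zE] znz.
have [B0 [bB0 B00 _]] := feasible_basis mu0 zE.
pose feas B := `[< is_basis B /\ forall i, 0 <= (z *m coords B) 0 i >].
have fB0 : feas B0 by apply/asboolP.
have [B /asboolP[bB BP] Bmin] := @Order.TotalTheory.arg_minP _ R _ B0 feas
  (fun B => cost (z *m coords B)) fB0.
have zU : (z <= U)%MS by rewrite zE submxMl.
have Bpos i : i \in B -> 0 < (z *m coords B) 0 i.
  by move=> iB; rewrite lt_neqAle eq_sym znz ?BP.
exists B; split=> // j; rewrite leNgt; apply/negP => red.
set la := z *m coords B in BP Bpos Bmin; set a := row j U *m coords B in red.
have [th th0 thP] := @small_multiplier _ _ (mem B) _ (fun i => a 0 i) Bpos.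
pose nu := la + th *: (delta_mx 0 j - a).
have nuE i : nu 0 i = la 0 i + th * ((i == j)%:R - a 0 i).
  by rewrite /nu; clearbody la a; rewrite !mxE.
have nu0 i : 0 <= nu 0 i.
  rewrite nuE; have [iB|iB] := boolP (i \in B); last first.
    rewrite [la 0 i]supported_coords // [a 0 i]supported_coords // subr0 add0r.
    by rewrite mulr_ge0 // ltW.
  have := thP i iB; have := ler_norm (a 0 i).
  move=> /(ler_wpM2l (ltW th0)) h1 h2.
  have : 0 <= th * (i == j)%:R by rewrite mulr_ge0 // ltW.
  by rewrite mulrBr; lra.
have nuU : z = nu *m U.
  rewrite mulmxDl coordsK // -scalemxAl mulmxBl coordsK ?row_sub //.
  by rewrite -rowE subrr scaler0 addr0.
have [B' [bB' B'P]] := feasible_basis nu0 nuU.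
have := Bmin B' (introT (asboolP _) (conj bB' B'P)) => h1 h2.
have := le_trans h1 h2; rewrite leNgt => /negP; apply.
rewrite /nu cost_lin gtrDl pmulr_rlt0 // -scaleN1r cost_lin mulN1r.
by rewrite {1}/cost -rowE mxE subr_lt0.
Qed.

End Cost.

(** * Generic costs, generic directions and the half-open cones *)

Definition red_cost (c : 'cV[R]_N) B j : R := c j 0 - cost c (row j U *m coords B).

(** Dual nondegeneracy, which makes the optimal basis unique; [generic_dir] is its primal
    counterpart. *)
Definition generic_cost (c : 'cV[R]_N) :=
  forall B j, is_basis B -> j \notin B -> red_cost c B j != 0.

Definition generic_dir (q : 'rV[R]_D) :=
  forall B i, is_basis B -> i \in B -> (q *m coords B) 0 i != 0.

(** Costs [T^i] on the moment curve turn each condition into the nonvanishing of a polynomial in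
    [T]. [p1] has coefficient 1 at [j], since coordinates in [B] vanish outside [B]; [p2] has
    coefficient 1 at [i], since a row in [B] has unit coordinates. The direction is the combination
    of the rows with the same positive weights. *)
Lemma exists_generic : exists (c : 'cV[R]_N) q,
  [/\ forall i, 0 < c i 0, in_cone q, generic_cost c & generic_dir q].
Proof.
pose p1 (Bj : {set 'I_N} * 'I_N) : {poly R} :=
  if `[< is_basis Bj.1 >] && (Bj.2 \notin Bj.1) then
    'X^(Bj.2) - \sum_(i < N) (row Bj.2 U *m coords Bj.1) 0 i *: 'X^i else 1.
pose p2 (Bi : {set 'I_N} * 'I_N) : {poly R} :=
  if `[< is_basis Bi.1 >] && (Bi.2 \in Bi.1) then
    \sum_(j < N) (row j U *m coords Bi.1) 0 Bi.2 *: 'X^j else 1.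
have coefsum (f : 'I_N -> R) (j : 'I_N) : (\sum_(i < N) f i *: 'X^i)`_j = f j.
  rewrite coef_sum (bigD1 j) //= coefZ coefXn eqxx mulr1 big1 ?addr0 // => i ij.
  by rewrite coefZ coefXn (_ : (nat_of_ord j == i) = false) ?mulr0 //;
    apply/negbTE; rewrite eq_sym.
have p1n0 Bj : p1 Bj != 0.
  case: Bj => B j; rewrite /p1 /=; case: ifP => [/andP[/asboolP bB jB]|_];
    last first.
    exact: oner_neq0.
  apply/eqP => /(congr1 (fun p : {poly R} => p`_j)).
  rewrite coefB coefXn eqxx coefsum supported_coords // subr0 coef0.
  by apply/eqP; rewrite oner_eq0.
have p2n0 Bi : p2 Bi != 0.
  case: Bi => B i; rewrite /p2 /=; case: ifP => [/andP[/asboolP bB iB]|_];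
    last first.
    exact: oner_neq0.
  apply/eqP => /(congr1 (fun p : {poly R} => p`_i)).
  rewrite (coefsum (fun j => (row j U *m coords B) 0 i)) coords_row // mxE !eqxx coef0.
  by apply/eqP; rewrite oner_eq0.
have [T T0 TP] := @common_nonroot _ _
  (fun s : {set 'I_N} * 'I_N + {set 'I_N} * 'I_N =>
    match s with inl a => p1 a | inr a => p2 a end)
  (fun s => match s with inl a => p1n0 a | inr a => p2n0 a end).
pose c : 'cV[R]_N := \col_i T ^+ i; exists c, (c^T *m U); split.
- by move=> i; rewrite mxE exprn_gt0.
- by exists c^T => // i; rewrite !mxE exprn_ge0 // ltW.
- move=> B j /asboolP bB jB; have := TP (inl (B, j)); rewrite /p1 /= bB jB /=.
  congr (_ != 0);
    rewrite hornerD hornerN hornerXn horner_sum /red_cost mxE costE.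
  by congr (_ - _); apply: eq_bigr => i _; rewrite hornerZ hornerXn [c _ _]mxE.
- move=> B i /asboolP bB iB; have := TP (inr (B, i)); rewrite /p2 /= bB iB /=.
  congr (_ != 0); rewrite horner_sum -mulmxA mxE; apply: eq_bigr => j _.
  by rewrite hornerZ hornerXn !mxE mulrC; congr (_ * _);
    apply: eq_bigr => k _; rewrite !mxE.
Qed.

(* The limit as [e] tends to [0+] of the open cone conditions on [x + e q]. *)
Definition half_open (q : 'rV[R]_D) B x := forall i, i \in B ->
  if 0 < (q *m coords B) 0 i then 0 <= (x *m coords B) 0 i
  else 0 < (x *m coords B) 0 i.

(** One [e] is small against all nonzero coordinates of [x] in all bases, so these keep their sign;
    a zero coordinate on a basis acquires the sign of that of [q], which is nonzero. Hence the
    choice between closed and open facets. *)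
Lemma perturbation q x : generic_dir q -> exists2 e, 0 < e &
  forall B, is_basis B -> (forall i, i \in B -> ((x + e *: q) *m coords B) 0 i != 0) /\
    (half_open q B x <-> forall i, i \in B -> 0 < ((x + e *: q) *m coords B) 0 i).
Proof.
move=> gq; pose X (Bi : {set 'I_N} * 'I_N) := (x *m coords Bi.1) 0 Bi.2.
have [|e e0 eP] := @small_multiplier R _ (fun Bi => X Bi != 0)
  (fun Bi => `|X Bi|) (fun Bi => (q *m coords Bi.1) 0 Bi.2).
  by move=> Bi; rewrite normr_gt0.
exists e => // B bB.
have E i : ((x + e *: q) *m coords B) 0 i = X (B, i) + e * (q *m coords B) 0 i.
  by rewrite mulmxDl -scalemxAl /X [LHS]mxE; congr (_ + _); rewrite mxE.
have key i : i \in B -> (X (B, i) + e * (q *m coords B) 0 i != 0) /\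
    ((if 0 < (q *m coords B) 0 i then 0 <= X (B, i) else 0 < X (B, i)) <->
      0 < X (B, i) + e * (q *m coords B) 0 i).
  move=> iB; have := gq B i bB iB; set y := (q *m coords B) 0 i => y0.
  have [X0|X0] := eqVneq (X (B, i)) 0.
    rewrite X0 add0r mulf_eq0 (gt_eqF e0) (negPf y0) pmulr_rgt0 //; split=> //.
    by case: ifP; rewrite ?lexx ?ltxx.
  have := eP (B, i) X0;
    rewrite /= -/y -[e in e * _](ger0_norm (ltW e0)) -normrM.
  set ey := e * y; set t := X (B, i) in X0 *; move: X0.
  case: (ltgtP t 0) => // t0 _;
    rewrite ?(gtr0_norm t0) ?(ltr0_norm t0) ltr_norml => /andP[h1 h2].
    split; first by apply/eqP; lra.
    by split; [case: ifP; lra | lra].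
  split; first by apply/eqP; lra.
  by split; [lra | case: ifP; lra].
split; first by move=> i iB; rewrite E; have [] := key i iB.
split=> h i iB; have [_ [k1 k2]] := key i iB; first by rewrite E; apply: k1;
  exact: h.
by apply: k2; rewrite -E; exact: h.
Qed.

Lemma optimal_half_open (c : 'cV[R]_N) q x : (forall i, 0 < c i 0) -> in_cone q -> generic_dir q ->
  in_cone x -> exists B, [/\ is_basis B, half_open q B x & forall j, 0 <= red_cost c B j].
Proof.
move=> c0 [nu n0 qE] gq [mu m0 xE]; have [e e0 eP] := perturbation x gq.
have zc : in_cone (x + e *: q).
  exists (mu + e *: nu); last by rewrite mulmxDl -scalemxAl -xE -qE.
  by move=> i; rewrite !mxE addr_ge0 // mulr_ge0 // ltW.
have [|B [bB Bp Bc]] := optimal_basis c0 zc.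
  by move=> B i bB; apply: (proj1 (eP B bB)).
exists B; split=> //; first by apply/(proj2 (eP B bB)).
by move=> j; rewrite subr_ge0.
Qed.

(** [S] collects the bases with nonnegative reduced costs, a choice independent of [x]. Such a basis
    with positive coordinates at the perturbed point is optimal there; existence is
    [optimal_half_open], and uniqueness comes from the generic cost. *)
Lemma half_open_decomposition : exists (S : {set {set 'I_N}}) (q : 'rV[R]_D),
  [/\ forall B, B \in S -> is_basis B,
      forall x, in_cone x -> exists2 B, B \in S & half_open q B x &
      forall x B B', (x <= U)%MS -> B \in S -> B' \in S ->
        half_open q B x -> half_open q B' x -> B = B'].
Proof.
have [c [q [c0 qc gc gq]]] := exists_generic.
pose S := [set B | `[< is_basis B /\ forall j, 0 <= red_cost c B j >]].
exists S, q; split.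
- by move=> B; rewrite inE => /asboolP[].
- move=> x xc; have [B [bB hB rB]] := optimal_half_open c0 qc gq xc.
  by exists B => //; rewrite inE; apply/asboolP.
move=> x B B' xU; rewrite inE => /asboolP[bB rB];
  rewrite inE => /asboolP[bB' rB'] hB hB'.
have [e e0 eP] := perturbation x gq; pose z := x + e *: q.
have zU : (z <= U)%MS.
  by case: qc => nu _ qE; rewrite addmx_sub // scalemx_sub // qE submxMl.
have zB := (proj2 (eP B bB)).1 hB; have zB' := (proj2 (eP B' bB')).1 hB'.
(* The cost gap between two bases is the pairing of the coordinates in one with the reduced costs of
   the other. Used both ways, it makes two nonnegative sums opposite, hence zero. *)
have compare A A' : is_basis A -> is_basis A' ->
   cost c (z *m coords A') - cost c (z *m coords A) =
   \sum_j (z *m coords A') 0 j * red_cost c A j.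
  move=> bA bA'; rewrite /red_cost.
  under eq_bigr do rewrite mulrBr.
  rewrite sumrB -costE; congr (_ - _).
  have -> : z *m coords A = z *m coords A' *m U *m coords A by rewrite coordsK.
  move: (z *m coords A') => la; rewrite /cost -!mulmxA mxE.
  by apply: eq_bigr => j _; rewrite rowE -!mulmxA -rowE [row _ _ _ _]mxE.
have pos (A A' : {set 'I_N}) : (forall j, 0 <= red_cost c A j) ->
    (forall i, i \in A' -> 0 < (z *m coords A') 0 i) ->
    forall j, 0 <= (z *m coords A') 0 j * red_cost c A j.
  move=> rA zA j; have [jA|jA] := boolP (j \in A').
    by rewrite mulr_ge0 // ltW // zA.
  by rewrite supported_coords // mul0r.
have sub (A A' : {set 'I_N}) : is_basis A -> is_basis A' -> (forall j, 0 <= red_cost c A j) ->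
    (forall j, 0 <= red_cost c A' j) ->
    (forall i, i \in A -> 0 < (z *m coords A) 0 i) ->
    (forall i, i \in A' -> 0 < (z *m coords A') 0 i) -> A' \subset A.
  move=> bA bA' rA rA' zA zA'.
  have h1 := compare _ _ bA bA'; have h2 := compare _ _ bA' bA.
  have p1 : 0 <= \sum_j (z *m coords A') 0 j * red_cost c A j.
    by apply: sumr_ge0 => j _; exact: pos.
  have p2 : 0 <= \sum_j (z *m coords A) 0 j * red_cost c A' j.
    by apply: sumr_ge0 => j _; exact: pos.
  have /eqP s0 : \sum_j (z *m coords A') 0 j * red_cost c A j = 0.
    by apply/eqP; rewrite eq_le p1 andbT -h1; move: p2; rewrite -h2; lra.
  (* For [j] in [A'] but not in [A], the term of the zero sum would be a product of a positive
     coordinate and a nonzero reduced cost. *)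
  apply/fintype.subsetP => j jA'; apply/negPn/negP => jA.
  move: s0; rewrite psumr_eq0 => [/allP /(_ j (mem_index_enum j)) /=|i _].
    by rewrite mulf_eq0 (gt_eqF (zA' j jA')) (negPf (gc A j bA jA)).
  exact: pos.
by apply/eqP; rewrite finset.eqEsubset !sub.
Qed.

(* With cost 2 on [v] and 1 elsewhere, an optimal basis representing generator
   [v] contains [v], and its dual solution attains the costs on the basis. *)
Lemma separate_generator v :
  (forall mu, (forall i, 0 <= mu 0 i) -> mu 0 v = 0 -> row v U <> mu *m U) ->
  exists y : 'cV[R]_D, forall j, j != v -> (row j U *m y) 0 0 < (row v U *m y) 0 0.
Proof.
move=> nv; have [_ [q [_ qc _ gq]]] := exists_generic.
pose c : 'cV[R]_N := \col_i (if i == v then 2 else 1).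
have c0 i : 0 < c i 0 by rewrite mxE; case: ifP.
have vc : in_cone (row v U).
  by exists (delta_mx 0 v); rewrite -?rowE // => i; rewrite mxE.
have [B [bB hB rB]] := optimal_half_open c0 qc gq vc.
have vB : v \in B.
  apply/negPn/negP => vB; apply: (nv (row v U *m coords B)).
  - move=> i; have [iB|iB] := boolP (i \in B); last by rewrite supported_coords.
    by have := hB i iB; case: ifP => // _; apply: ltW.
  - by rewrite supported_coords.
  - by rewrite coordsK // row_sub.
exists (coords B *m c) => j jv; rewrite !(mulmxA _ (coords B) c).
have := rB j; rewrite subr_ge0 [c j 0]mxE (negPf jv) /cost => h;
  apply: le_lt_trans h _.
by rewrite coords_row // -rowE !mxE eqxx ltr1n.
Qed.

(** The rows in [B], gathered in [V], are free and span the row space of [U]. Thus all half-open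
    cones share the same denominator exponent. *)
Lemma card_basis B : is_basis B -> #|B| = \rank U.
Proof.
move=> [iB UB].
pose V := \matrix_(i < #|B|) row (enum_val i) U.
have VE (nu : 'rV[R]_#|B|) : nu *m V =
    (\row_j \sum_(i | enum_val i == j) nu 0 i) *m U.
  rewrite !mulmx_sum_row.
  rewrite (eq_bigr (fun i => nu 0 i *: row (enum_val i) U)); last first.
    by move=> i _; rewrite rowK.
  rewrite [LHS](partition_big enum_val xpredT) //=; apply: eq_bigr => j _.
  by rewrite mxE scaler_suml; apply: eq_bigr => i /eqP ->.
have fV : row_free V.
  apply/inj_row_free => nu; rewrite VE => /iB h.
  have {}h := h _; apply/rowP => i.
  have /rowP/(_ (enum_val i)) : \row_j \sum_(i | enum_val i == j) nu 0 i = 0.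
    apply: h => j jB; rewrite mxE big1 // => k /eqP kj.
    by rewrite -kj enum_valP in jB.
  by rewrite !mxE (big_pred1 i) // => k; rewrite (inj_eq enum_val_inj).
rewrite -(eqP (fV : \rank V == _)); apply/eqP; rewrite eqn_leq; apply/andP;
  split.
  by apply: mxrankS; apply/row_subP => i; rewrite rowK row_sub.
apply: leq_trans (mxrankS UB) _; apply: mxrankS; apply/row_subP => i.
rewrite row_mul row_diag_mx -scalemxAl -rowE mxE;
  have [iB'|_] := boolP (i \in B); last by rewrite scale0r sub0mx.
rewrite scale1r -(enum_rankK_in iB' iB') -(rowK (fun i : 'I_#|B| => row (enum_val i) U)).
exact: row_sub.
Qed.

End LinearProgram.

(** * Vertices, cone and dimension of a polytope *)

Section Polytope.
Variables (R : realType) (d : nat).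
Implicit Types (s t : seq 'rV[R]_d) (P : set 'rV[R]_d).

Definition points_mx s : 'M[R]_(size s, d) := \matrix_i s`_i.

Definition homogenize s : 'M[R]_(size s, d + 1) :=
  row_mx (points_mx s) (const_mx 1).

Lemma mul_const1 n (mu : 'rV[R]_n) :
  mu *m const_mx 1 = const_mx (\sum_i mu 0 i) :> 'M[R]_1.
Proof.
apply/matrixP => i j; rewrite !mxE !ord1; apply: eq_bigr => k _.
by rewrite mxE mulr1.
Qed.

Lemma mul_homogenize s (mu : 'rV[R]_(size s)) : mu *m homogenize s =
  row_mx (mu *m points_mx s) (const_mx (\sum_i mu 0 i)).
Proof. by rewrite mul_mx_row mul_const1. Qed.

Lemma row_homogenize s i : row i (homogenize s) = row_mx s`_i (const_mx 1).
Proof. by rewrite row_row_mx rowK row_const. Qed.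

Lemma mul_points s (mu : 'rV[R]_(size s)) :
  mu *m points_mx s = \sum_i mu 0 i *: s`_i.
Proof. by rewrite mulmx_sum_row; apply: eq_bigr => i _; rewrite rowK. Qed.

Lemma hullP s x : convex_hull s x <-> exists mu : 'rV[R]_(size s),
  [/\ forall i, 0 <= mu 0 i, \sum_i mu 0 i = 1 & x = mu *m points_mx s].
Proof.
split=> [[c [c0 c1 ->]]|[mu [mu0 mu1 ->]]].
  exists (\row_i c i); split.
  - by move=> i; rewrite mxE.
  - by under eq_bigr do rewrite mxE.
  - by rewrite mul_points; apply: eq_bigr => i _; rewrite mxE.
by exists (fun i => mu 0 i); split; rewrite ?mul_points.
Qed.

Lemma mem_hull s x : x \in s -> convex_hull s x.
Proof.
move=> /(nthP 0)[i ilt <-]; apply/hullP; exists (delta_mx 0 (Ordinal ilt));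
  split.
- by move=> j; rewrite mxE.
- rewrite (bigD1 (Ordinal ilt)) //= mxE !eqxx big1 ?addr0 // => j /negPf ji.
  by rewrite mxE ji andbF.
- by rewrite -rowE rowK.
Qed.

(** Points of weight zero are left unconstrained, so that a generator absent from a combination can
    be discarded. *)
Lemma hull_convex s n (c : 'rV[R]_n) (y : 'I_n -> 'rV[R]_d) :
  (forall i, 0 <= c 0 i) -> \sum_i c 0 i = 1 ->
  (forall i, c 0 i != 0 -> convex_hull s (y i)) ->
  convex_hull s (\sum_i c 0 i *: y i).
Proof.
move=> c0 c1 ys.
have ex i : exists mu : 'rV[R]_(size s), [/\ forall j, 0 <= mu 0 j,
    c 0 i * \sum_j mu 0 j = c 0 i & c 0 i *: y i = c 0 i *: (mu *m points_mx s)].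
  have [ci|ci] := eqVneq (c 0 i) 0.
    by exists 0; split=> [j||]; rewrite ?ci ?mul0r ?scale0r ?mxE.
  have /hullP[mu [h1 h2 h3]] := ys i ci.
  by exists mu; split; [exact: h1|rewrite h2 mulr1|rewrite h3].
have [f fP] := choice ex; apply/hullP.
exists (\sum_i c 0 i *: f i); split.
- move=> j; rewrite summxE sumr_ge0 // => i _; rewrite mxE mulr_ge0 //.
  by case: (fP i).
- under eq_bigr do rewrite summxE.
  rewrite exchange_big /= -c1; apply: eq_bigr => i _; have [_ E _] := fP i;
    rewrite -[RHS]E.
  by rewrite mulr_sumr; apply: eq_bigr => j _; rewrite mxE.
- rewrite mulmx_suml; apply: eq_bigr => i _; case: (fP i) => _ _ ->.
  by rewrite -scalemxAl.
Qed.

Lemma hull_subset s t : (forall i : 'I_(size s), convex_hull t s`_i) ->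
  forall x, convex_hull s x -> convex_hull t x.
Proof.
move=> st x /hullP[mu [m0 m1 ->]]; rewrite mul_points.
exact: hull_convex.
Qed.

(* A generating sequence of minimal length consists of vertices. *)
Lemma vertex_sequence P s0 : P = convex_hull s0 ->
  exists2 s, P = convex_hull s & forall i : 'I_(size s), is_vertex P s`_i.
Proof.
move=> P0.
pose Q n := `[< exists2 s, size s = n & P = convex_hull s >].
have exQ : exists n, Q n by exists (size s0); apply/asboolP; exists s0.
have [n /asboolP[s sn PE] nmin] := ex_minnP exQ.
exists s => // v.
have Ps (i : 'I_(size s)) : convex_hull s s`_i by apply/mem_hull/mem_nth.
have [mu mu0 muv rowv|y yP] := @separate_generator R _ _ (homogenize s) v.
  (* Were row [v] a nonnegative combination of the other rows, the point would be a convex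
     combination of the other points, and dropping it would contradict minimal length. *)
  pose t := [seq s`_(i : 'I_(size s)) | i <- enum (predC1 v)].
  have tj (j : 'I_(size s)) : j != v -> convex_hull t s`_j.
    by move=> jv; apply/mem_hull/map_f; rewrite mem_enum.
  have mu1 : \sum_i mu 0 i = 1 /\ s`_v = mu *m points_mx s.
    move: rowv; rewrite row_homogenize mul_homogenize => /eq_row_mx[h1 h2].
    by split=> //; move/matrixP/(_ 0 0): h2; rewrite !mxE.
  have tv : convex_hull t s`_v.
    rewrite mu1.2 mul_points; apply: hull_convex => //; first by case: mu1.
    by move=> j mj; apply: tj; apply: contraNneq mj => ->; rewrite muv.
  have Pt : P = convex_hull t.
    rewrite PE; apply/seteqP; split; apply: hull_subset.
      by move=> j; have [->//|/tj] := eqVneq j v.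
    move=> j; apply/mem_hull; have /mapP[k _ ->] := mem_nth 0 (ltn_ord j).
    exact: mem_nth.
  have := nmin (size t) (introT (asboolP _) (ex_intro2 _ _ t erefl Pt)).
  by rewrite size_map -cardE cardC1 card_ord -sn; have := ltn_ord v; lia.
(* The homogenised points all end in 1, so the last entry of [y] adds the same constant to both
   sides. *)
have {}yP (j : 'I_(size s)) : j != v ->
    (s`_j *m usubmx y) 0 0 < (s`_v *m usubmx y) 0 0.
  have E (p : 'rV[R]_d) : (row_mx p (const_mx 1) *m y) 0 0 =
      (p *m usubmx y) 0 0 + ((const_mx 1 : 'M[R]_1) *m dsubmx y) 0 0.
    by rewrite -{1}[y]vsubmxK mul_row_col [LHS]mxE.
  by move=> /yP; rewrite !row_homogenize !E ltrD2r.
split; first by rewrite PE.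
exists (usubmx y) => x; rewrite PE => -[c [c0 c1 xE]] xv.
(* The gap at [x] is the weighted mean of the gaps at the generators, and it vanishes only if all
   the weight sits at [v]. *)
have E : (s`_v *m usubmx y) 0 0 - (x *m usubmx y) 0 0 =
    \sum_i c i * ((s`_v *m usubmx y) 0 0 - (s`_i *m usubmx y) 0 0).
  under [RHS]eq_bigr do rewrite mulrBr.
  rewrite sumrB -mulr_suml c1 mul1r; congr (_ - _).
  rewrite xE mulmx_suml summxE; apply: eq_bigr => i _.
  by rewrite -scalemxAl mxE.
have t0 i : 0 <= c i * ((s`_v *m usubmx y) 0 0 - (s`_i *m usubmx y) 0 0).
  have [->|iv] := eqVneq i v; first by rewrite subrr mulr0.
  by rewrite mulr_ge0 // subr_ge0 ltW // yP.
rewrite -subr_gt0 E lt_neqAle sumr_ge0 // andbT eq_sym psumr_eq0 //.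
apply/negP => /allP h; apply: xv.
have ci i : i != v -> c i = 0.
  move=> iv; have := h i (mem_index_enum i).
  have d0 : 0 < (s`_v *m usubmx y) 0 0 - (s`_i *m usubmx y) 0 0.
    by rewrite subr_gt0 yP.
  by rewrite mulf_eq0 (gt_eqF d0) orbF => /eqP.
have cv : c v = 1.
  by rewrite -c1 (bigD1 v) //= big1 ?addr0 // => i /ci.
rewrite xE (bigD1 v) //= cv scale1r big1 ?addr0 // => i /ci ->.
by rewrite scale0r.
Qed.

Lemma vertex_dilate P v q : (0 < q)%N -> is_vertex P v ->
  is_vertex (dilate q P) (q%:R *: v).
Proof.
move=> q0 [Pv [c cP]]; split; first by exists v.
exists c => _ [x Px <-] xv; rewrite -!scalemxAl !mxE ltr_pM2l ?ltr0n //.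
by have := cP x Px; rewrite !mxE; apply => xE; apply: xv; rewrite xE.
Qed.

Lemma cone_homogenize P s (a : R) : P = convex_hull s -> (P !=set0)%classic -> 0 < a ->
  forall x, cone P x <-> in_cone (a *: homogenize s) x.
Proof.
move=> PE P0 a0 x; split.
  move=> [c [p [c0]]]; rewrite PE => /hullP[mu [m0 m1 ->]] ->.
  exists ((c / a) *: mu) => [i|].
    by rewrite mxE mulr_ge0 // divr_ge0 // ltW.
  by rewrite -scalemxAl -scalemxAr scalerA divfK ?gt_eqF // mul_homogenize m1.
move=> [mu m0 ->]; rewrite -scalemxAr mul_homogenize.
set c := \sum_i mu 0 i.
have [c0|c0] := eqVneq c 0.
  (* Total weight zero means [mu = 0], the apex of the cone; membership in [cone P] needs some point
     of [P], so nonemptiness enters here. *)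
  have [p Pp] := P0; exists 0, p => //; rewrite scale0r c0.
  have -> : mu = 0.
    apply/rowP => i; move/eqP: c0;
      rewrite psumr_eq0 // => /allP/(_ i (mem_index_enum i)).
    by rewrite [RHS]mxE => /eqP.
  by rewrite mul0mx (_ : const_mx 0 = 0) ?row_mx0 ?scaler0 //;
    apply/matrixP => i j; rewrite !mxE.
have cp : 0 <= c by apply: sumr_ge0.
exists (a * c), (c^-1 *: (mu *m points_mx s)).
  split; first by rewrite mulr_ge0 // ltW.
  rewrite PE; apply/hullP; exists (c^-1 *: mu); split.
  - by move=> i; rewrite mxE mulr_ge0 // invr_ge0.
  - by under eq_bigr do rewrite mxE; rewrite -mulr_sumr mulVf.
  - by rewrite scalemxAl.
rewrite -scalerA; congr (_ *: _); rewrite scale_row_mx scalerA divff // scale1r.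
by congr row_mx; apply/matrixP => i j; rewrite !mxE mulr1.
Qed.

Lemma homogenize_sub s p : convex_hull s p ->
  (row_mx p (const_mx 1 : 'M[R]_1) <= homogenize s)%MS.
Proof.
move=> /hullP[mu [_ m1 ->]]; rewrite -m1 -mul_homogenize; exact: submxMl.
Qed.

(** Appending the coordinate 1 turns the [k + 1] affinely independent points into linearly
    independent vectors of the row space. *)
Lemma affine_simplex_rank P s k : P = convex_hull s ->
  has_affine_simplex P k -> (k < \rank (homogenize s))%N.
Proof.
move=> PE [x [M [Px PM fM]]]; rewrite PE in Px PM.
pose W := col_mx (row_mx x (const_mx 1 : 'M[R]_1)) (row_mx M 0).
have fW : row_free W.
  apply/inj_row_free => v;
    rewrite -[v]hsubmxK mul_row_col !mul_mx_row add_row_mx.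
  rewrite mulmx0 addr0 mul_const1 -row_mx0 => /eq_row_mx[h1 h2].
  have l0 : lsubmx v = 0.
    apply/matrixP => i j; move/matrixP/(_ 0 0): h2.
    rewrite mxE [X in _ = X -> _]mxE big_ord1 => h; by rewrite !ord1 h mxE.
  rewrite l0; rewrite l0 mul0mx add0r in h1.
  by rewrite (row_free_inj fM (etrans h1 (esym (mul0mx _ _)))) row_mx0.
rewrite -[k.+1]/(1 + k)%N -(eqP (fW : \rank W == _)); apply: mxrankS.
rewrite col_mx_sub homogenize_sub //=; apply/row_subP => i.
have -> : row i (row_mx M (0 : 'M[R]_(k, 1))) =
    row_mx (x + row i M) (const_mx 1) - row_mx x (const_mx 1).
  by rewrite row_row_mx opp_row_mx add_row_mx row0 subrr addrC addKr.
by rewrite addmx_sub ?eqmx_opp ?homogenize_sub.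
Qed.

Lemma dimension_hull P s : P = convex_hull s -> (P !=set0)%classic ->
  (dimension P + 1)%R = (\rank (homogenize s))%:Z.
Proof.
move=> PE P0; rewrite /dimension asboolF; last by apply/nonemptyPn; exact.
have [s0] : exists v : 'I_(size s), true.
  case: P0 => x; rewrite PE => -[c [_ c1 _]].
  case: (posnP (size s)) => [s0|s0]; last by exists (Ordinal s0).
  move: c c1; rewrite s0 => c /esym; rewrite big_ord0 => /eqP.
  by rewrite oner_eq0.
move=> _.
have Ps (i : 'I_(size s)) : P s`_i by rewrite PE; apply/mem_hull/mem_nth.
(* The differences to a base point span the directions of the affine hull; a maximal free set of
   them gives a simplex of top dimension. *)
pose M0 : 'M[R]_(size s, d) := \matrix_i (s`_i - s`_s0).
have simp : has_affine_simplex P (\rank M0).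
  exists s`_s0, (rowsub (maxrankfun M0) M0); split=> //.
    by move=> i; rewrite row_rowsub rowK addrC subrK.
  exact: maxrowsub_free.
have r1 := affine_simplex_rank PE simp.
have r2 : (\rank (homogenize s) <= (\rank M0).+1)%N.
  have : (homogenize s <= row_mx s`_s0 (const_mx 1 : 'M[R]_1) + row_mx M0 0)%MS.
    apply/row_subP => i.
    have -> : row i (homogenize s) = row_mx s`_s0 (const_mx 1) +
        row i (row_mx M0 (0 : 'M[R]_(size s, 1))).
      by rewrite row_homogenize row_row_mx rowK row0 add_row_mx addr0 addrC subrK.
    by rewrite addmx_sub_adds // row_sub.
  move=> /mxrankS /leq_trans; apply; apply: leq_trans (mxrank_adds_leqif _ _) _.
  by rewrite rank_row_mx0 -[leqRHS]add1n leq_add ?rank_leq_row.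
have rE : \rank (homogenize s) = (\rank M0).+1 by apply/eqP;
  rewrite eqn_leq r2 r1.
rewrite rE -[(\rank M0).+1]addn1 PoszD; congr (Posz _ + _); apply/eqP;
  rewrite eqn_leq; apply/andP; split.
  apply/bigmax_leqP => k /asboolP /(affine_simplex_rank PE).
  by rewrite rE ltnS.
have rd : (\rank M0 < d.+1)%N by rewrite ltnS rank_leq_col.
by apply: (@leq_bigmax_cond _ _ (fun k : 'I_d.+1 => k : nat) (Ordinal rd));
  apply/asboolP.
Qed.

End Polytope.

(** * Weights in the coordinates of the generators *)

Section Substitution.
Variables (R : realType) (N D : nat) (U : 'M[R]_(N, D)).
Implicit Types (w l : {mpoly R[D]}).

Definition pull_form (j : 'I_D) : {mpoly R[N]} := \sum_i U i j *: 'X_i.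

Definition pull w : {mpoly R[N]} := w \mPo [tuple pull_form j | j < D].

Lemma pull_eval w (x : 'I_N -> R) : (pull w).@[x] = evalmp w ((\row_i x i) *m U).
Proof.
rewrite comp_mpoly_meval; apply: meval_eq => j.
rewrite tnth_mktuple mxE raddf_sum /=; apply: eq_bigr => i _.
by rewrite mevalZ mevalXU mxE mulrC.
Qed.

Lemma homog_prodE n (I : Type) (r : seq I) (F : I -> {mpoly R[n]}) (e : I -> nat) :
  (forall i, F i \is (e i).-homog) ->
  \prod_(i <- r) F i \is (\sum_(i <- r) e i).-homog.
Proof.
move=> Fe; elim: r => [|i r IH]; first by rewrite !big_nil dhomog1.
by rewrite !big_cons dhomogM.
Qed.

Lemma pull_homog w m : w \is m.-homog -> pull w \is m.-homog.
Proof.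
move=> wm; rewrite /pull comp_mpolyE big_seq rpred_sum // => e ew.
apply: dhomogZ; rewrite -(dhomog_mf wm ew) /= mdegE.
apply: homog_prodE => j; rewrite tnth_mktuple.
suff /(dhomogMn (e j)) : pull_form j \is 1.-homog by rewrite mul1n.
by rewrite rpred_sum // => i _; apply: dhomogZ; rewrite dhomogX /= mdeg1.
Qed.

Definition nonneg_coefs n (p : {mpoly R[n]}) := forall e, 0 <= p@_e.

Lemma nonneg_coefsM n (p q : {mpoly R[n]}) :
  nonneg_coefs p -> nonneg_coefs q -> nonneg_coefs (p * q).
Proof.
move=> p0 q0 e; rewrite mcoeffM; apply: sumr_ge0 => k _; exact: mulr_ge0.
Qed.

(** The coefficient of [X_i] in the pulled-back form is the value of the form at generator [i]. *)
Lemma pull_linear_nonneg l : linear_form l ->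
  (forall i, 0 <= evalmp l (row i U)) -> nonneg_coefs (pull l).
Proof.
move=> l1 lU e; have pl := pull_homog l1.
have [/mdeg1P[i /eqP ->]|e1] := boolP (mdeg e == 1%N); last first.
  by rewrite (dhomog_nemf_coeff pl).
suff -> : (pull l)@_U_(i) = evalmp l (row i U) by [].
have -> : row i U = (\row_k (k == i)%:R) *m U.
  by rewrite rowE; congr (_ *m _); apply/rowP => k; rewrite !mxE.
rewrite -(pull_eval l (fun k => (k == i)%:R)) mevalE.
have E f : mdeg f = 1%N -> \prod_k (k == i)%:R ^+ f k = (f == U_(i)%MM)%:R :> R.
  move=> /eqP/mdeg1P[k /eqP ->]; have [->|ki] := eqVneq k i.
    rewrite eqxx big1 // => j _; rewrite mnm1E.
    by case: eqVneq => _; rewrite ?expr1n ?expr0.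
  rewrite (bigD1 k) //= (negPf ki) mnm1E eqxx expr1 mul0r.
  rewrite (_ : (U_(k) == U_(i))%MM = false) //; apply/negbTE.
  by apply: contraNneq ki => /mnmP/(_ k); rewrite !mnm1E eqxx eq_sym; case: eqP.
rewrite big_seq (eq_bigr (fun f => (pull l)@_f * (f == U_(i)%MM)%:R));
  last first.
  by move=> f fl; rewrite E // (dhomog_mf pl fl).
rewrite -big_seq; have [iin|iout] := boolP (U_(i)%MM \in msupp (pull l)).
  rewrite (bigD1_seq U_(i)%MM) //= eqxx mulr1 big1 ?addr0 // => f /negPf ->.
  by rewrite mulr0.
rewrite memN_msupp_eq0 // big1_seq // => f /= fl.
by rewrite (_ : f == _ = false) ?mulr0 //; apply: contraNF iout => /eqP <-.
Qed.

Lemma pull_nonneg_coefs (s : seq (R * seq {mpoly R[D]})) :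
  (forall t, t \in s -> 0 < t.1 /\ forall l, l \in t.2 ->
     linear_form l /\ forall i, 0 <= evalmp l (row i U)) ->
  nonneg_coefs (pull (\sum_(t <- s) t.1 *: \prod_(l <- t.2) l)).
Proof.
move=> h e; rewrite /pull (raddf_sum (comp_mpoly _)) raddf_sum big_seq;
  apply: sumr_ge0 => t /h[t0 tl].
rewrite /= comp_mpolyZ mcoeffZ mulr_ge0 ?(ltW t0) //.
rewrite rmorph_prod /= big_seq.
apply: (big_ind (fun p => nonneg_coefs p)) e => [e|p q|l /tl[l1 lU]].
- by rewrite mcoeff1; case: (e == 0%MM).
- exact: nonneg_coefsM.
- exact: pull_linear_nonneg.
Qed.

End Substitution.

Lemma evalmp_sum_ge0 (R : realType) n (C : set 'rV[R]_n)
    (s : seq (seq {mpoly R[n]})) :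
  (forall t, t \in s -> nonneg_on C (\prod_(l <- t) l)) ->
  nonneg_on C (\sum_(t <- s) \prod_(l <- t) l).
Proof.
move=> h x Cx; rewrite /evalmp raddf_sum big_seq; apply: sumr_ge0 => t ts.
exact: h.
Qed.

(** * Integer parts relative to half-open unit intervals *)

Lemma floor_half_open (R : realType) (b : bool) (t : R) :
  (if b then 0 <= t else 0 < t) ->
  exists k : nat, if b then 0 <= t - k%:R < 1 else 0 < t - k%:R <= 1.
Proof.
case: b => t0.
  exists (Num.truncn t); have := truncn_itv t0.
  by rewrite -natr1; lra.
have := truncn_itv (ltW t0); set k := Num.truncn t => kt.
have [tk|tk] := eqVneq t k%:R; last first.
  by exists k; move: kt; rewrite -natr1 le_eqVlt eq_sym (negPf tk) /=; lra.
(* With the convention that excludes 0 and includes 1, an integer [t] takes the predecessor of its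
   floor, available because [t > 0]. *)
move: tk t0; case: (k) => [|k'] ->; first by rewrite ltxx.
by exists k' ; rewrite -natr1; lra.
Qed.

Lemma half_open_shift_unique (R : realType) (b : bool) (t t' : R) (k k' : nat) :
  (if b then 0 <= t < 1 else 0 < t <= 1) ->
  (if b then 0 <= t' < 1 else 0 < t' <= 1) ->
  t + k%:R = t' + k'%:R -> k = k'.
Proof.
move=> ht ht' E.
have h : `|(k%:Z - k'%:Z)%:~R| < 1 :> R.
  rewrite rmorphB /= -!pmulrn ltr_norml; case: b ht ht' => *; lra.
have : `|k%:Z - k'%:Z| < 1 by rewrite -(ltr_int R) intr_norm.
lia.
Qed.

(** * Lattice points of the half-open cones *)

Section LatticePoints.
Variables (R : realType) (d N : nat) (P : set 'rV[R]_d).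
Variables (delta : nat) (U : 'M[int]_(N, d + 1)).
Let UR : 'M[R]_(N, d + 1) := map_mx intr U.
Let last : 'I_(d + 1) := rshift d ord0.
Hypothesis delta_gt0 : (0 < delta)%N.
Hypothesis U_last : forall i, U i last = delta%:Z.
Hypothesis coneE : forall x, cone P x <-> in_cone UR x.
Hypothesis slice_finite : forall n, finite_set (slice P n).
Variables (S : {set {set 'I_N}}) (q : 'rV[R]_(d + 1)).
Hypothesis S_basis : forall B, B \in S -> is_basis UR B.
Hypothesis S_cover :
  forall x, in_cone UR x -> exists2 B, B \in S & half_open UR q B x.
Hypothesis S_disjoint : forall x B B', (x <= UR)%MS -> B \in S -> B' \in S ->
  half_open UR q B x -> half_open UR q B' x -> B = B'.
Implicit Types (x y : 'rV[int]_(d + 1)) (B : {set 'I_N}).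

Definition real_row x : 'rV[R]_(d + 1) := map_mx intr x.

Definition lcoord B x (i : 'I_N) : R := (real_row x *m coords UR B) 0 i.

(** Half-open fundamental parallelepiped, closed at 0 in the same directions as [half_open]. The row
    space condition is there because [coords] reconstructs a vector only inside that space. *)
Definition box B y := (real_row y <= UR)%MS /\ forall i, i \in B ->
  if 0 < (q *m coords UR B) 0 i then 0 <= lcoord B y i < 1
  else 0 < lcoord B y i <= 1.

Lemma lcoord_out B x i : i \notin B -> lcoord B x i = 0.
Proof. exact: supported_coords. Qed.

Lemma height_coords B x : is_basis UR B -> (real_row x <= UR)%MS ->
  (x 0 last)%:~R = delta%:R * \sum_i lcoord B x i :> R.
Proof.
move=> bB xU; have := coordsK bB xU => /rowP/(_ last).
rewrite mxE [RHS]mxE => <-; rewrite mulr_sumr; apply: eq_bigr => i _.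
by rewrite [UR _ _]mxE U_last mulrC.
Qed.

Lemma box_coord B y : box B y -> forall i, 0 <= lcoord B y i <= 1.
Proof.
move=> [_ h] i; have [iB|iB] := boolP (i \in B); last first.
  by rewrite lcoord_out // lexx ler01.
by have := h i iB; case: ifP; lra.
Qed.

Lemma coord_in_cone B x : is_basis UR B -> (real_row x <= UR)%MS ->
  (forall i, 0 <= lcoord B x i) -> in_cone UR (real_row x).
Proof.
by move=> bB xU x0; exists (real_row x *m coords UR B); rewrite ?coordsK.
Qed.

(** At most [N] generators of height [delta] are used, each with coefficient at most 1. So the boxes
    only meet finitely many slices. *)
Lemma box_height B y : B \in S -> box B y ->
  exists2 n, (n <= delta * N)%N & slice P n y.
Proof.
move=> BS By; have bB := S_basis BS; have yU := By.1.
have l01 := box_coord By.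
have hE := height_coords bB yU.
have s0 : 0 <= \sum_i lcoord B y i.
  by apply: sumr_ge0 => i _; have /andP[] := l01 i.
have s1 : \sum_i lcoord B y i <= N%:R.
  rewrite -[X in _ <= X%:R](card_ord N) -sumr_const.
  by apply: ler_sum => i _; have /andP[] := l01 i.
have y0 : 0 <= y 0 last by rewrite -(ler_int R) hE mulr_ge0.
exists (absz (y 0 last)).
  rewrite -lez_nat gez0_abs // -(ler_int R) hE -pmulrn natrM ler_pM2l ?ltr0n //.
split; last by rewrite gez0_abs.
apply/coneE; apply: (coord_in_cone bB yU) => i.
by have /andP[] := l01 i.
Qed.

Lemma box_finite : exists s : seq 'rV[int]_(d + 1),
  forall B y, B \in S -> box B y -> y \in s.
Proof.
have ex n : exists s : seq 'rV[int]_(d + 1), slice P n = [set` s]%classic.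
  exact/finite_seqP/slice_finite.
have [f fP] := choice ex.
exists (flatten [seq f n | n <- iota 0 (delta * N).+1]) => B y BS By.
have [n nd ny] := box_height BS By.
apply/flattenP; exists (f n); first by rewrite map_f // mem_iota ltnS.
by move: ny; rewrite fP.
Qed.

Variable Ys : seq 'rV[int]_(d + 1).
Hypothesis YsP : forall B y, B \in S -> box B y -> y \in Ys.

Definition height y : nat := absz (y 0 last).

Section Truncation.
Variable M : nat.
(** A basis, a box point and a shift vector; bounding the shifts by [M] makes this a finite type,
    large enough for all heights up to [M]. *)
Local Notation T := ({set 'I_N} * seq_sub Ys * {ffun 'I_N -> 'I_M.+1})%type.
Implicit Type t : T.

Definition shift_row (k : {ffun 'I_N -> 'I_M.+1}) : 'rV[int]_N :=
  \row_i (k i : nat)%:Z.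

Definition point t : 'rV[int]_(d + 1) := val t.1.2 + shift_row t.2 *m U.

Definition valid t := [&& t.1.1 \in S, `[< box t.1.1 (val t.1.2) >] &
  supported_in t.1.1 t.2].

Definition point_height t : nat := (height (val t.1.2) + delta * \sum_i t.2 i)%N.

Lemma supported_inP B (k : {ffun 'I_N -> 'I_M.+1}) :
  reflect (forall i, i \notin B -> k i = ord0) (supported_in B k).
Proof.
apply: (iffP familyP) => h i.
  by move=> iB; have := h i; rewrite inE (negPf iB) => /eqP.
by rewrite inE; have [//|iB /=] := boolP (i \in B); rewrite h.
Qed.

Lemma real_rowD x y : real_row (x + y) = real_row x + real_row y.
Proof. exact: map_mxD. Qed.

Lemma real_row_mul (k : 'rV[int]_N) : real_row (k *m U) = map_mx intr k *m UR.
Proof. exact: map_mxM. Qed.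

Lemma point_coord t i : valid t ->
  lcoord t.1.1 (point t) i = lcoord t.1.1 (val t.1.2) i + (t.2 i)%:R.
Proof.
case: t => -[B y] k /and3P[/= BS _ /supported_inP kB].
rewrite /lcoord /point /= real_rowD real_row_mul mulmxDl (coords_unique (S_basis BS)).
  by rewrite [LHS]mxE; congr (_ + _); rewrite !mxE.
by move=> j jB; rewrite !mxE kB.
Qed.

Lemma point_sub t : valid t -> (real_row (point t) <= UR)%MS.
Proof.
case: t => -[B y] k /and3P[/= BS /asboolP[yU _] _].
by rewrite real_rowD real_row_mul addmx_sub ?submxMl.
Qed.

Lemma point_half_open t : valid t -> half_open UR q t.1.1 (real_row (point t)).
Proof.
move=> vt i iB; have := point_coord i vt; rewrite /lcoord => ->.
have /and3P[_ /asboolP[_ h] _] := vt; move: (h i iB).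
have : 0 <= (t.2 i)%:R :> R by [].
by rewrite /lcoord; case: ifP; lra.
Qed.

Lemma point_last t : valid t -> point t 0 last = (point_height t)%:Z.
Proof.
move=> vt; have /and3P[BS /asboolP By _] := vt.
have [n _ [_ yn]] := box_height BS By.
rewrite /point_height /height /last yn absz_nat PoszD PoszM.
rewrite 2!mxE yn; congr (_ + _).
rewrite (big_morph Posz PoszD erefl) mulr_sumr; apply: eq_bigr => i _.
by rewrite U_last mxE mulrC.
Qed.

Lemma point_slice t : valid t -> slice P (point_height t) (point t).
Proof.
move=> vt; split; last exact: point_last.
have /and3P[BS /asboolP By _] := vt.
apply/coneE; apply: (coord_in_cone (S_basis BS) (point_sub vt)) => i.
by rewrite point_coord // addr_ge0 //; have /andP[] := box_coord By i.
Qed.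

(** Disjointness of the half-open cones recovers the basis, the integer parts of the coordinates
    recover the shift, and subtraction recovers the box point. *)
Lemma point_inj t t' : valid t -> valid t' -> point t = point t' -> t = t'.
Proof.
move=> vt vt' E; have /and3P[BS /asboolP By kB] := vt.
have /and3P[BS' /asboolP By' kB'] := vt'.
have eB : t.1.1 = t'.1.1.
  apply: (S_disjoint (point_sub vt)) => //; first exact: point_half_open.
  by rewrite E; exact: point_half_open.
have ek : t.2 = t'.2.
  apply/ffunP => i; have [iB|iB] := boolP (i \in t.1.1); last first.
    have /supported_inP -> // := kB.
    by have /supported_inP -> // := kB'; rewrite -eB.
  apply/val_inj/(half_open_shift_unique (By.2 i iB)); last first.
    by rewrite -point_coord // E eB point_coord.
  by rewrite eB; apply: By'.2; rewrite -eB.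
have ey : t.1.2 = t'.1.2.
  by apply/val_inj; move: E; rewrite /point ek => /addIr.
by move: eB ek ey; case: (t) (t') => [[? ?] ?] [[? ?] ?] /= -> -> ->.
Qed.

Lemma slice_point n x : (n <= M)%N -> slice P n x ->
  exists2 t, valid t && (point_height t == n) & x = point t.
Proof.
move=> nM [/coneE xc xn]; have [B BS hB] := S_cover xc.
have bB := S_basis BS.
have xU : (real_row x <= UR)%MS by case: xc => mu _ xE;
  rewrite /real_row xE submxMl.
have lx0 i : 0 <= lcoord B x i.
  have [iB|iB] := boolP (i \in B); last by rewrite lcoord_out.
  by have := hB i iB; case: ifP => // _; apply: ltW.
have ex i : exists k : nat, if i \in B then
     (if 0 < (q *m coords UR B) 0 i then 0 <= lcoord B x i - k%:R < 1
      else 0 < lcoord B x i - k%:R <= 1) else k == 0%N.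
  have [iB|iB] := boolP (i \in B); last by exists 0%N.
  exact/floor_half_open/hB.
have [k kP] := choice ex.
(* Each generator has height at least 1, so a point of height [n] uses no more than [n] copies; the
   truncation at [M] loses nothing. *)
have kn i : (k i <= n)%N.
  have := kP i; case: ifPn => [iB h|_ /eqP -> //]; rewrite -(ler_nat R).
  have kl : (k i)%:R <= lcoord B x i by move: h; case: ifP; lra.
  apply: le_trans kl _.
  have := height_coords bB xU; rewrite xn -pmulrn => ->.
  rewrite (bigD1 i) //= mulrDr.
  have d1 : 1 <= delta%:R :> R by rewrite ler1n.
  apply: ler_wpDr; first by rewrite mulr_ge0 // sumr_ge0.
  by rewrite ler_peMl.
pose kf : {ffun 'I_N -> 'I_M.+1} := [ffun i => inord (k i)].
have kfE i : kf i = k i :> nat by rewrite ffunE inordK // ltnS (leq_trans (kn i)).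
have kB : supported_in B kf.
  apply/supported_inP => i iB; apply/ord_inj; rewrite kfE.
  by have := kP i; rewrite (negPf iB) => /eqP.
pose y := x - shift_row kf *m U.
have yE : real_row y = real_row x - map_mx intr (shift_row kf) *m UR.
  by rewrite -real_row_mul; exact: map_mxB.
have By : box B y.
  split; first by rewrite yE addmx_sub // eqmx_opp submxMl.
  move=> i iB; have -> : lcoord B y i = lcoord B x i - (k i)%:R.
    rewrite /lcoord yE mulmxBl coords_unique //; last first.
      by move=> j jB; rewrite !mxE (supported_inP _ _ kB).
    by rewrite [LHS]mxE; congr (_ + _); rewrite !mxE kfE.
  by have := kP i; rewrite iB.
pose t : T := (B, SeqSub (YsP BS By), kf).
have vt : valid t by apply/and3P; split => //=; apply/asboolP.
have xt : x = point t by rewrite /point /= subrK.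
exists t => //; rewrite vt /=; have := point_last vt; rewrite -xt xn => -[->].
exact: eqxx.
Qed.

Variable (w : {mpoly R[d + 1]}).

Lemma ehr_coef_points n : (n <= M)%N -> ehr_coef P w n =
  \sum_(t : T | valid t && (point_height t == n)) evalmp w (real_row (point t)).
Proof.
move=> nM; pose r := [seq point t | t <- enum {: T} & valid t && (point_height t == n)].
have ur : uniq r.
  rewrite map_inj_in_uniq => [|t t']; first exact/filter_uniq/enum_uniq.
  rewrite !mem_filter => /andP[/andP[vt _] _] /andP[/andP[vt' _] _].
  exact: point_inj.
have -> : ehr_coef P w n = \sum_(x <- r) evalmp w (real_row x).
  rewrite /ehr_coef (fsbig_seq _ _ ur); apply: eq_fsbigl.
  apply/seteqP; split => x /=.
    move=> /(slice_point nM)[t vt ->]; apply: map_f.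
    by rewrite mem_filter vt mem_enum.
  move=> /mapP[t]; rewrite mem_filter => /andP[/andP[vt /eqP <-] _] ->.
  exact: point_slice.
by rewrite big_map big_filter big_enum_cond.
Qed.

Let g := pull UR w.

(** Substituting [X^delta] accounts for the height [delta] of every generator. *)
Lemma orthant_sum_comp B y : is_basis UR B -> (real_row y <= UR)%MS ->
  orthant_sum g B (lcoord B y) M \Po 'X^delta =
  \sum_(k : {ffun 'I_N -> 'I_M.+1} | supported_in B k)
    evalmp w (real_row (y + shift_row k *m U)) *: 'X^(delta * \sum_i k i).
Proof.
move=> bB yU; rewrite /orthant_sum raddf_sum /=; apply: eq_bigr => k _.
rewrite comp_polyZ comp_Xn_poly -exprM pull_eval; congr (evalmp w _ *: _).
rewrite real_rowD real_row_mul -(coordsK bB yU) -mulmxDl; congr (_ *m _).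
by apply/rowP => i; rewrite [LHS]mxE [RHS]mxE; congr (_ + _); rewrite !mxE.
Qed.

Lemma coef_box_sum n : (n <= M)%N -> ehr_coef P w n =
  (\sum_(B in S) \sum_(y : seq_sub Ys | `[< box B (val y) >])
     'X^(height (val y)) * (orthant_sum g B (lcoord B (val y)) M \Po 'X^delta))`_n.
Proof.
move=> nM; rewrite ehr_coef_points // pair_big_dep /=.
rewrite (eq_bigr (fun By => \sum_(k : {ffun 'I_N -> 'I_M.+1} | supported_in By.1 k)
   evalmp w (real_row (point (By, k))) *: 'X^(point_height (By, k))));
     last first.
  move=> [B y] /= /andP[BS /asboolP By].
  rewrite (orthant_sum_comp (S_basis BS) By.1).
  rewrite mulr_sumr; apply: eq_bigr => k _.
  by rewrite -scalerAr -exprD.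
rewrite pair_big_dep /= coef_sum [RHS](bigID (fun t => point_height t == n)) /=.
rewrite [X in _ = _ + X]big1 ?addr0 => [|[[B y] k] /= /andP[_ hn]].
  apply: eq_big => [[[B y] k]|[[B y] k] /= /andP[_ /eqP hn]].
    by rewrite /valid /= !andbA.
  by rewrite coefZ hn coefXn eqxx mulr1.
by rewrite coefZ coefXn eq_sym (negPf hn) mulr0.
Qed.

End Truncation.

Variables (w : {mpoly R[d + 1]}) (m : nat).
Let g := pull UR w.

Definition hstar_boxes : {poly R} :=
  \sum_(B in S) \sum_(y : seq_sub Ys | `[< box B (val y) >])
     'X^(height (val y)) * (orthant_num g B (lcoord B (val y)) \Po 'X^delta).

(** The Ehrhart coefficients up to [n] come from the truncation at [n]. On each box
    [orthant_sum_mod] leaves an error divisible by [X^(delta (n + 1))], which does not reach degree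
    [n]. *)
Lemma hstar_boxesP n : w \is m.-homog -> hstar_boxes`_n =
  \sum_(i < n.+1) ((1 - 'X^delta) ^+ (m + \rank UR))`_i * ehr_coef P w (n - i).
Proof.
move=> wm.
rewrite (eq_bigr (fun i : 'I_n.+1 => ((1 - 'X^delta) ^+ (m + \rank UR))`_i *
  (\sum_(B in S) \sum_(y : seq_sub Ys | `[< box B (val y) >])
     'X^(height (val y)) * (orthant_sum g B (lcoord B (val y)) n \Po 'X^delta))`_(n - i)));
  last by move=> i _; rewrite -coef_box_sum // leq_subr.
rewrite -coefM mulr_sumr !coef_sum; apply: eq_bigr => B BS.
rewrite mulr_sumr !coef_sum; apply: eq_bigr => y _.
have [|E EE] := @orthant_sum_mod _ _ g B (lcoord B (val y)) n m (pull_homog UR wm).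
  by move=> i; exact: lcoord_out.
rewrite mulrCA.
have -> : (1 - 'X^delta) ^+ (m + \rank UR) = (1 - 'X) ^+ (m + #|B|) \Po 'X^delta :> {poly R}.
  by rewrite (card_basis (S_basis BS)) rmorphXn /= rmorphB /= rmorph1 comp_polyX.
rewrite -rmorphM /= EE comp_polyD comp_polyM comp_Xn_poly mulrDr coefD.
rewrite [X in _ = _ + X](_ : _ = 0) ?addr0 // -exprM mulrA -exprD coefXnM.
by rewrite ifT //; nia.
Qed.

Lemma hstar_boxes_coef_ge0 n : nonneg_coefs g -> 0 <= hstar_boxes`_n.
Proof.
move=> g0; rewrite coef_sum; apply: sumr_ge0 => B BS.
rewrite coef_sum; apply: sumr_ge0 => y /asboolP By.
rewrite coefXnM; case: ifP => // _; rewrite coef_comp_poly_Xn //.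
by case: ifP => // _; apply: orthant_num_coef_ge0 => //; exact: box_coord.
Qed.

Lemma hstar_boxes_ge0 t : w \is m.-homog -> nonneg_on (cone P) w ->
  0 <= t -> 0 <= hstar_boxes.[t].
Proof.
move=> wm w0 t0; rewrite horner_sum; apply: sumr_ge0 => B BS.
rewrite horner_sum; apply: sumr_ge0 => y /asboolP By.
rewrite hornerM horner_comp !hornerXn mulr_ge0 ?exprn_ge0 //.
apply: (@orthant_num_ge0 _ _ _ _ _ m) => //.
- move=> x x0; rewrite pull_eval; apply/w0/coneE.
  by exists (\row_i x i) => // i; rewrite mxE.
- exact: pull_homog.
- exact: box_coord.
- by move=> i; exact: lcoord_out.
- exact: exprn_ge0.
Qed.

End LatticePoints.

(** * Construction of the weighted numerator for a rational polytope *)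

Lemma ehr_coef_set0 (R : realType) (d : nat) (w : {mpoly R[d + 1]}) n :
  ehr_coef set0 w n = 0.
Proof.
rewrite /ehr_coef (_ : slice _ n = set0) ?fsbig_set0 //.
by apply/seteqP; split => // x [[c [p [_ []]]]].
Qed.

Lemma hstar_exists (R : realType) (d : nat) (P : set 'rV[R]_d) (m : nat)
    (w : {mpoly R[d + 1]}) : rational_polytope P -> w \is m.-homog ->
  exists h, [/\ is_weighted_hstar P m w h,
    semiring_R P w -> forall i, 0 <= h`_i &
    nonneg_on (cone P) w -> forall t, 0 <= t -> 0 <= h.[t]].
Proof.
move=> hP wm; have [P0|/eqP/set0P P0] := pselect (P = set0).
  exists 0; split=> [n|_ i|_ t _]; rewrite ?coef0 ?horner0 //.
  by rewrite big1 // => i _; rewrite P0 ehr_coef_set0 mulr0.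
have [[dl0 dlP] _] := denominatorP hP; have [s0 PE0] := hP.
have [s PE sv] := vertex_sequence PE0.
have ex (i : 'I_(size s)) := dlP _ (vertex_dilate dl0 (sv i)).
have [z zE] := choice ex.
set dl := denominator P in dl0 zE *.
(* The rows are [delta (v_i, 1)], integral because the denominator clears the vertices. *)
pose U : 'M[int]_(size s, d + 1) := \matrix_i row_mx (z i) (const_mx dl%:Z).
have URE : map_mx intr U = dl%:R *: homogenize s :> 'M[R]_(size s, d + 1).
  apply/row_matrixP => i; rewrite -map_row rowK map_row_mx -zE linearZ /=.
  rewrite row_homogenize scale_row_mx; congr row_mx.
  by apply/matrixP => j k; rewrite !mxE mulr1.
have dlR : 0 < dl%:R :> R by rewrite ltr0n.
have Ul i : U i (rshift d ord0) = dl%:Z by rewrite mxE row_mxEr mxE.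
have coneE x : cone P x <-> in_cone (map_mx intr U) x.
  by rewrite URE; exact: cone_homogenize.
have fin n : finite_set (slice P n) by exact: finite_slice.
have [S [q [S1 S2 S3]]] := half_open_decomposition (map_mx intr U : 'M[R]_(_, _)).
have [Ys YsP] := box_finite dl0 Ul coneE fin q S1.
exists (hstar_boxes dl U S q Ys w); split.
- move=> n; rewrite (hstar_boxesP dl0 Ul coneE S1 S2 S3 YsP _ wm) /hstar_denom.
  (* The rank of the generators is [dim P + 1], and the scaling by [delta] does not change it. *)
  suff -> : absz (dimension P + m%:Z + 1) = (m + \rank (map_mx intr U : 'M[R]_(_, _)))%N by [].
  rewrite addrAC (dimension_hull PE P0) URE mxrank_scale_nz ?gt_eqF //.
  by rewrite -PoszD absz_nat addnC.
- move=> [t [tP wE]] i; apply: (hstar_boxes_coef_ge0 dl0).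
  rewrite wE; apply: pull_nonneg_coefs => u /tP[u0 ul]; split=> // l /ul[l1 l0].
  split=> // j; apply/l0/coneE; exists (delta_mx 0 j); last exact: rowE.
  by move=> k; rewrite mxE.
- by move=> w0 t t0; exact: (hstar_boxes_ge0 _ coneE _ _ _ wm).
Qed.

Theorem theorem2p6 (R : realType) (d : nat) (P : set 'rV[R]_d)
    (hP : rational_polytope P) :
  (forall (m : nat) (w : {mpoly R[d + 1]}),
     w \is m.-homog -> semiring_R P w ->
     exists2 h : {poly R}, is_weighted_hstar P m w h &
       forall i : nat, 0 <= h`_i) /\
  (forall (m : nat) (w : {mpoly R[d + 1]}),
     w \is m.-homog -> semiring_S P w ->
     exists2 h : {poly R}, is_weighted_hstar P m w h &
       forall t : R, 0 <= t -> 0 <= h.[t]).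
Proof.
split=> m w wm wP; have [h [hh h1 h2]] := hstar_exists hP wm; exists h => //.
  exact: h1.
(* Membership in the semiring enters only through the nonnegativity of the weight on the cone. *)
apply: h2; case: wP => s [sP ->]; apply: evalmp_sum_ge0 => t ts.
by have [] := sP t ts.
Qed.
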